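(* Let $\gamma\in[0,1)$, let $k\ge0$ be an integer, and suppose that $f\in\mathcal{B}(\Omega_\gamma)$ has the expansion $$f(z)=\sum_{n=k}^{\infty}a_n\left(z+\frac{\gamma}{1-\gamma}\right)^n.$$ Put $a=|a_k|/(1-\gamma)^k$. Then $$\sum_{n=k}^{\infty}\frac{|a_n|}{(1-\gamma)^{n}}\rho^n+\left(\frac{\rho^{-k}}{1+a}+\frac{\rho^{1-k}}{1-\rho}\right)\|f\|_\rho^2\le 1\quad\text{for }\rho\le\rho_k(a),$$ where $\rho_k(a)$ is the root in $(0,1)$ of the equation $$(2a^2-1)\rho^{k+1}-a(1+2a)\rho^k-(1+a)\rho+1+a=0.$$ The radius $\rho_k(a)$ is the best possible for each $a\in(0,1)$.
   Context: For $\gamma\in[0,1)$, $\Omega_\gamma=\{z\in\mathbb{C}:|z+\frac{\gamma}{1-\gamma}|<\frac{1}{1-\gamma}\}$. For a domain $\Omega\subseteq\mathbb{C}$, $\mathcal{B}(\Omega)$ is the class of analytic functions $f$ on $\Omega$ with $f(\Omega)\subseteq\overline{\mathbb{D}}$, where $\mathbb{D}$ is the open unit disk. For $f(z)=\sum_{n=k}^\infty a_n(z+\frac{\gamma}{1-\gamma})^n$ on $\Omega_\gamma$, $\|f\|_\rho^2=\sum_{n=k}^{\infty}\frac{|a_n|^2}{(1-\gamma)^{2n}}\rho^{2n}$. The variable $\rho$ ranges over $(0,1)$. ''Best possible for $a$'' means that, for this value of $a$, $\rho_k(a)$ cannot be replaced by a larger number: for every $\rho\in(\rho_k(a),1)$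 there is a function $f$ satisfying the hypotheses with $|a_k|/(1-\gamma)^k=a$ for which the inequality fails at $\rho$.
   Formalization: For k=0 and a ≥ 1/√2 the equation has no root in (0,1), so ρ_0(a) is undefined; existence and uniqueness of the root are claimed only for k≥1 or 2a²<1, and the inequality and sharpness are stated only when the root exists. *)

(* Defs.v *)
From Stdlib Require Import Reals.
From Coquelicot Require Import Coquelicot.
Open Scope R_scope.

Definition center (gamma : R) : R := - (gamma / (1 - gamma)).

Definition Omega (gamma : R) (z : C) : Prop :=
  Cmod (z - RtoC (center gamma))%C < 1 / (1 - gamma).

(* On an open set, analytic means complex-differentiable at every point.
   The normed module is given explicitly because [C] also carries the
   structure of a real normed module. *)
Definition analytic_on (D : C -> Prop) (f : C -> C) : Prop :=
  forall z : C, D z -> @ex_derive C_AbsRing C_NormedModule f z.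

(* Functions on [D] are total functions whose values outside [D] are ignored. *)
Definition classB (D : C -> Prop) (f : C -> C) : Prop :=
  analytic_on D f /\ (forall z : C, D z -> Cmod (f z) <= 1).

(* All series below start at [n = k]; the index is shifted to [n = k + m], and
   the values [c n] with [n < k] play no role. *)
Definition has_expansion (gamma : R) (k : nat) (f : C -> C) (c : nat -> C)
  : Prop :=
  forall z : C, Omega gamma z ->
    @is_series C_AbsRing C_NormedModule
      (fun m : nat =>
         (c (k + m)%nat * (z - RtoC (center gamma)) ^ (k + m))%C)
      (f z).

Definition lead (gamma : R) (k : nat) (c : nat -> C) : R :=
  Cmod (c k) / (1 - gamma) ^ k.

Definition major_term (gamma : R) (k : nat) (c : nat -> C) (rho : R) (m : nat)
  : R :=
  Cmod (c (k + m)%nat) / (1 - gamma) ^ (k + m) * rho ^ (k + m).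

Definition norm_term (gamma : R) (k : nat) (c : nat -> C) (rho : R) (m : nat)
  : R :=
  Cmod (c (k + m)%nat) ^ 2 / (1 - gamma) ^ (2 * (k + m))
    * rho ^ (2 * (k + m)).

Definition norm_sq (gamma : R) (k : nat) (c : nat -> C) (rho : R) : R :=
  Series (norm_term gamma k c rho).

(* [Series] is a total operator, so [bohr_lhs] is only meaningful together
   with this convergence statement. *)
Definition bohr_summable (gamma : R) (k : nat) (c : nat -> C) (rho : R)
  : Prop :=
  ex_series (major_term gamma k c rho) /\ ex_series (norm_term gamma k c rho).

Definition bohr_lhs (gamma : R) (k : nat) (c : nat -> C) (rho : R) : R :=
  Series (major_term gamma k c rho)
  + (powerRZ rho (- Z.of_nat k) / (1 + lead gamma k c)
     + powerRZ rho (1 - Z.of_nat k) / (1 - rho))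
    * norm_sq gamma k c rho.

Definition is_rho (k : nat) (a r : R) : Prop :=
  0 < r < 1 /\
  (2 * a ^ 2 - 1) * r ^ (k + 1) - a * (1 + 2 * a) * r ^ k - (1 + a) * r + 1 + a
  = 0.

(* Main.v *)
Require Import Defs.
From Stdlib Require Import Reals Lra Lia.
From Coquelicot Require Import Coquelicot.
Open Scope R_scope.

(** After the change of variable [w = (1 - gamma) (z - center)] and division
    by [w ^ k], the numbers [b m = c (k + m) / (1 - gamma) ^ (k + m)] are the
    Taylor coefficients of a function bounded by [1] on the unit disk, and
    [a = |b 0|].  The left-hand side of the inequality becomes
    [rho ^ k] times
      [sum |b m| rho ^ m
       + (1 / (1 + a) + rho / (1 - rho)) sum |b m|^2 rho ^ (2 m)]
    (lemma [bohr_lhs_eq]).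

    The key is Carlson's form of the coefficient bound: for [N >= 1],
      [|b N| + sum_(2 i < N) |b i|^2 + [N = 2 i] |b i|^2 / (1 + a) <= 1].
    Multiplied by [rho ^ N] and summed over [N], the coefficient [|b i|^2]
    collects [rho ^ (2 i) (1 / (1 + a) + rho / (1 - rho))], which is exactly its
    weight above.  With the term [a + a^2 / (1 + a)] for [N = 0] this bounds the
    left-hand side by
      [bohr_majorant k a rho = rho ^ k (a + a^2 / (1 + a) + rho / (1 - rho))].
    The majorant increases with [rho], and the equation defining the radius
    says that it equals [1]; this gives uniqueness of the radius as well as the
    inequality, while existence is the intermediate value theorem for the
    polynomial, which is positive at [0] and negative at [1].  For [w ^ k (a - w) / (1 - a w)] the left-hand
    side is equal to the majorant, so it exceeds [1] beyond the radius.

    Carlson's inequality ([carlson_inequality]) comes from the fact that the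
    lower triangular Toeplitz matrix of the [b m] is a contraction
    ([toeplitz_form_bound]), tested on vectors that single out [b N] and add a
    multiple of the conjugates of the first half of the coefficients.  The
    matrix is a contraction because the Toeplitz form of a polynomial is an
    average over sufficiently many roots of unity, and a power series is
    uniformly close to its partial sums on a circle of radius [r < 1].
    Division by [w ^ k] costs a factor [1 / r ^ k] on that circle, which tends
    to [1] with [r]. *)

(** * Finite sums *)

Lemma sum_n_rev {G : AbelianMonoid} (u : nat -> G) (n : nat) :
  sum_n (fun i => u (n - i)%nat) n = sum_n u n.
Proof.
  revert u; induction n as [|n IH]; intros u.
  - now rewrite !sum_O.
  - rewrite sum_Sn, Nat.sub_diag.
    rewrite (sum_n_ext_loc _ (fun i => u (S (n - i))))
      by (intros i Hi; f_equal; lia).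
    rewrite (IH (fun i => u (S i))).
    unfold sum_n; rewrite (sum_n_m_S u), (sum_Sn_m u 0) by lia.
    apply plus_comm.
Qed.

Lemma sum_n_unique_term {G : AbelianMonoid} (u : nat -> G) (n p : nat) :
  (p <= n)%nat -> (forall i, (i <= n)%nat -> i <> p -> u i = zero) ->
  sum_n u n = u p.
Proof.
  induction n as [|n IH]; intros Hp H.
  - rewrite sum_O; f_equal; lia.
  - rewrite sum_Sn.
    destruct (Nat.eq_dec p (S n)) as [->|Hne].
    + rewrite (sum_n_ext_loc _ (fun _ => zero)) by (intros; apply H; lia).
      unfold sum_n; rewrite sum_n_m_const_zero; apply plus_zero_l.
    + rewrite (H (S n)) by lia. rewrite plus_zero_r.
      apply IH; [lia|]; intros; apply H; lia.
Qed.

(** Fixing the monoid makes the summation lemmas rewrite with the operations of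
    [C] instead of the generic ones. *)
Definition Csum (u : nat -> C) (n : nat) : C := @sum_n C_AbelianMonoid u n.

Lemma Csum_O (u : nat -> C) : Csum u 0 = u O.
Proof. exact (sum_O (G := C_AbelianMonoid) u). Qed.

Lemma Csum_S (u : nat -> C) (n : nat) : Csum u (S n) = (Csum u n + u (S n))%C.
Proof. exact (sum_Sn (G := C_AbelianMonoid) u n). Qed.

Lemma Csum_ext (u v : nat -> C) (n : nat) :
  (forall i, (i <= n)%nat -> u i = v i) -> Csum u n = Csum v n.
Proof. exact (sum_n_ext_loc (G := C_AbelianMonoid) u v n). Qed.

Lemma Csum_plus (u v : nat -> C) (n : nat) :
  Csum (fun i => u i + v i)%C n = (Csum u n + Csum v n)%C.
Proof. exact (sum_n_plus (G := C_AbelianMonoid) u v n). Qed.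

Lemma Csum_mult_l (z : C) (u : nat -> C) (n : nat) :
  Csum (fun i => z * u i)%C n = (z * Csum u n)%C.
Proof. exact (sum_n_mult_l (K := C_Ring) z u n). Qed.

Lemma Csum_mult_r (z : C) (u : nat -> C) (n : nat) :
  Csum (fun i => u i * z)%C n = (Csum u n * z)%C.
Proof. exact (sum_n_mult_r (K := C_Ring) z u n). Qed.

Lemma Csum_switch (u : nat -> nat -> C) (m n : nat) :
  Csum (fun i => Csum (u i) n) m = Csum (fun j => Csum (fun i => u i j) m) n.
Proof. exact (sum_n_switch (G := C_AbelianMonoid) u m n). Qed.

Lemma Csum_rev (u : nat -> C) (n : nat) :
  Csum (fun i => u (n - i)%nat) n = Csum u n.
Proof. exact (sum_n_rev (G := C_AbelianMonoid) u n). Qed.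

Lemma Csum_unique_term (u : nat -> C) (n p : nat) :
  (p <= n)%nat -> (forall i, (i <= n)%nat -> i <> p -> u i = 0) ->
  Csum u n = u p.
Proof. exact (sum_n_unique_term (G := C_AbelianMonoid) u n p). Qed.

Lemma Csum_product (u v : nat -> C) (m n : nat) :
  (Csum u m * Csum v n)%C = Csum (fun i => Csum (fun j => u i * v j)%C n) m.
Proof.
  rewrite <- Csum_mult_r; apply Csum_ext; intros i _.
  now rewrite Csum_mult_l.
Qed.

Lemma Csum_conj (u : nat -> C) (n : nat) :
  Cconj (Csum u n) = Csum (fun i => Cconj (u i)) n.
Proof.
  induction n as [|n IH].
  - now rewrite !Csum_O.
  - now rewrite !Csum_S, Cplus_conj, IH.
Qed.

Lemma Csum_RtoC (u : nat -> R) (n : nat) :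
  Csum (fun i => RtoC (u i)) n = RtoC (sum_n u n).
Proof.
  induction n as [|n IH].
  - now rewrite Csum_O, sum_O.
  - rewrite Csum_S, sum_Sn, IH, <- RtoC_plus; reflexivity.
Qed.

Lemma Cmod_Csum_le (u : nat -> C) (n : nat) :
  Cmod (Csum u n) <= sum_n (fun i => Cmod (u i)) n.
Proof.
  exact (norm_sum_n_m (K := C_AbsRing) (V := C_NormedModule) u 0 n).
Qed.

Lemma sum_n_Rle (u v : nat -> R) (n : nat) :
  (forall i, (i <= n)%nat -> u i <= v i) -> sum_n u n <= sum_n v n.
Proof.
  induction n as [|n IH]; intros H.
  - rewrite !sum_O; apply H; lia.
  - rewrite !sum_Sn; apply Rplus_le_compat; [apply IH; intros|]; apply H; lia.
Qed.

(** Equalities of complex or real numbers arising from the generic summation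
    lemmas live in the carrier of an algebraic structure; [ring] only sees
    them after the carrier is unfolded. *)
Ltac eq_in T := match goal with |- ?x = ?y => change (x = y :> T) end.

(** * Averaging over roots of unity *)

Definition unit_root (M : nat) : C :=
  (cos (2 * PI / INR M), sin (2 * PI / INR M)).

Lemma unit_root_pow (M n : nat) :
  (unit_root M ^ n)%C
  = (cos (INR n * (2 * PI / INR M)), sin (INR n * (2 * PI / INR M))).
Proof.
  induction n as [|n IH].
  - simpl; rewrite Rmult_0_l, cos_0, sin_0; reflexivity.
  - rewrite Cpow_S, IH, S_INR, Rmult_plus_distr_r, Rmult_1_l.
    rewrite cos_plus, sin_plus; unfold unit_root, Cmult; simpl.
    f_equal; ring.
Qed.

Lemma Cmod_unit_root_pow (M n : nat) : Cmod (unit_root M ^ n)%C = 1.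
Proof.
  rewrite unit_root_pow; unfold Cmod; cbn [fst snd].
  rewrite <- sqrt_1; f_equal.
  generalize (sin2_cos2 (INR n * (2 * PI / INR M))); unfold Rsqr; nra.
Qed.

Lemma unit_root_order (M : nat) : (0 < M)%nat -> (unit_root M ^ M)%C = 1.
Proof.
  intros HM; apply lt_0_INR in HM.
  rewrite unit_root_pow.
  replace (INR M * (2 * PI / INR M)) with (2 * PI) by (field; lra).
  now rewrite cos_2PI, sin_2PI.
Qed.

(** [cos (2 t) = 1] forces [sin t = 0], which is impossible for
    [t = PI d / M] strictly between [0] and [PI]. *)
Lemma unit_root_primitive (M d : nat) :
  (0 < d < M)%nat -> (unit_root M ^ d)%C <> 1.
Proof.
  intros [Hd HM] E; rewrite unit_root_pow in E.
  apply lt_0_INR in Hd as Hd'; apply lt_INR in HM as HM'.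
  set (t := INR d * (PI / INR M)).
  assert (Ht : 0 < t < PI).
  { assert (HPI := PI_RGT_0); unfold t; split.
    - apply Rmult_lt_0_compat; [lra|]; apply Rdiv_lt_0_compat; lra.
    - replace (INR d * (PI / INR M)) with (PI * (INR d / INR M)) by (field; lra).
      rewrite <- (Rmult_1_r PI) at 2; apply Rmult_lt_compat_l; [lra|].
      apply Rlt_div_l; lra. }
  assert (Hs := sin_gt_0 t (proj1 Ht) (proj2 Ht)).
  apply (f_equal fst) in E; simpl in E.
  replace (INR d * (2 * PI / INR M)) with (2 * t) in E
    by (unfold t; field; lra).
  rewrite cos_2a_sin in E; nra.
Qed.

Lemma Cmod_one_conj (z : C) : Cmod z = 1 -> (z * Cconj z)%C = 1.
Proof. intros H; rewrite <- Cmod2_conj, H; f_equal; ring. Qed.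

Lemma Csum_geom (v : C) (n : nat) :
  ((1 - v) * Csum (fun l => v ^ l) n)%C = (1 - v ^ S n)%C.
Proof.
  induction n as [|n IH].
  - rewrite Csum_O; simpl; ring.
  - rewrite Csum_S, Cmult_plus_distr_l, IH, (Cpow_S v (S n)); ring.
Qed.

(** The summand is [v ^ l] with [v = u ^ (p - q)], an [S L]-th root of unity
    that is [1] only if [p = q]: the bounds on [p] and [q] exclude aliasing. *)
Lemma unit_root_orthogonality (L p q : nat) :
  (p <= L)%nat -> (q <= L)%nat ->
  Csum (fun l => let w := (unit_root (S L) ^ l)%C in w ^ p * Cconj w ^ q)%C L
  = if Nat.eq_dec p q then RtoC (INR (S L)) else RtoC 0.
Proof.
  intros Hp Hq; cbv zeta.
  set (u := unit_root (S L)).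
  assert (Hu : (u * Cconj u)%C = 1).
  { apply Cmod_one_conj; unfold u.
    rewrite <- (Cpow_1_r (unit_root (S L))); apply Cmod_unit_root_pow. }
  set (v := (u ^ p * Cconj u ^ q)%C).
  rewrite (Csum_ext _ (fun l => v ^ l)%C).
  2:{ intros l _; unfold v.
      rewrite Cpow_mult_l, Cpow_conj, <- !Cpow_mult_r.
      now rewrite (Nat.mul_comm p), (Nat.mul_comm q). }
  assert (Hq1 : (Cconj u ^ q * u ^ q)%C = 1).
  { rewrite <- Cpow_mult_l, (Cmult_comm (Cconj u)), Hu; apply Cpow_1_l. }
  destruct (Nat.eq_dec p q) as [->|Hne].
  - assert (Hv : v = 1) by (unfold v; rewrite Cmult_comm; exact Hq1).
    rewrite Hv, (Csum_ext _ (fun _ => RtoC 1)) by (intros; apply Cpow_1_l).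
    rewrite (Csum_RtoC (fun _ => 1)), sum_n_const; f_equal; ring.
  - assert (Hv : v <> 1).
    { intros Hv.
      assert (E : (u ^ p)%C = (u ^ q)%C).
      { rewrite <- (Cmult_1_l (u ^ q)%C), <- Hv; unfold v.
        rewrite <- Cmult_assoc, Hq1; ring. }
      assert (Hd : forall s t, (s < t)%nat -> (t <= L)%nat ->
                     (u ^ s)%C <> (u ^ t)%C).
      { intros s t Hst Ht Est.
        apply (unit_root_primitive (S L) (t - s)); [lia|]; fold u.
        replace t with (s + (t - s))%nat in Est by lia.
        rewrite Cpow_add_r in Est.
        assert (Hnz : (u ^ s)%C <> 0).
        { intros Z; generalize (Cmod_unit_root_pow (S L) s); fold u.
          rewrite Z, Cmod_0; lra. }
        apply (f_equal (Cmult (/ u ^ s))) in Est.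
        rewrite Cinv_l, Cmult_assoc, Cinv_l, Cmult_1_l in Est by exact Hnz.
        now symmetry. }
      destruct (Nat.lt_ge_cases p q); [now apply (Hd p q)|].
      apply (Hd q p); [lia|lia|now symmetry]. }
    assert (Hpow : (v ^ S L)%C = 1).
    { unfold v; rewrite Cpow_mult_l, <- !Cpow_mult_r.
      rewrite (Nat.mul_comm p), (Nat.mul_comm q), !Cpow_mult_r.
      rewrite <- Cpow_conj; unfold u; rewrite unit_root_order by lia.
      rewrite <- Cpow_conj, !Cpow_1_l.
      unfold Cconj, Cmult, RtoC; simpl; f_equal; ring. }
    assert (G := Csum_geom v L); rewrite Hpow in G.
    assert (Hnz : (1 - v)%C <> 0).
    { intros Z; apply Hv; symmetry.
      replace (RtoC 1) with ((1 - v) + v)%C by ring; rewrite Z; ring. }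
    rewrite <- (Cmult_1_l (Csum _ L)), <- (Cinv_l _ Hnz), <- Cmult_assoc, G.
    ring.
Qed.

(** * Toeplitz forms of bounded functions *)

Definition trig_poly (x : nat -> C) (N : nat) (w : C) : C :=
  Csum (fun j => x j * w ^ j)%C N.

Definition toeplitz_entry (b : nat -> C) (i j : nat) : C :=
  if (j <=? i)%nat then b (i - j)%nat else 0.

Definition toeplitz_form (b x y : nat -> C) (N : nat) : C :=
  Csum (fun i => Csum (fun j => y i * toeplitz_entry b i j * x j) N)%C N.

Definition mass (x : nat -> C) (N : nat) : R :=
  sum_n (fun j => Cmod (x j) ^ 2) N.

(** Sampling at points of the circle turns a product of a function, a polynomial
    and a polynomial in the conjugate variable into a bilinear form; only the
    moments of the function remain to be evaluated. *)
Lemma sample_expand (node F : nat -> C) (x y : nat -> C) (N L : nat) :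
  Csum (fun l => F l * trig_poly x N (node l)
                 * trig_poly y N (Cconj (node l)))%C L
  = Csum (fun i => Csum (fun j => y i
      * Csum (fun l => F l * (node l ^ j * Cconj (node l) ^ i)) L * x j) N)%C N.
Proof.
  transitivity (Csum (fun l => Csum (fun i => Csum (fun j =>
    y i * (F l * (node l ^ j * Cconj (node l) ^ i)) * x j) N) N)%C L).
  - apply Csum_ext; intros l _; unfold trig_poly.
    rewrite <- Cmult_assoc, (Cmult_comm (Csum _ N)), Csum_product, <- Csum_mult_l.
    apply Csum_ext; intros i _; rewrite <- Csum_mult_l.
    apply Csum_ext; intros j _; ring.
  - rewrite Csum_switch; apply Csum_ext; intros i _.
    rewrite Csum_switch; apply Csum_ext; intros j _.
    now rewrite Csum_mult_r, Csum_mult_l.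
Qed.

Lemma mass_nonneg (x : nat -> C) (N : nat) : 0 <= mass x N.
Proof.
  unfold mass; induction N as [|N IH].
  - rewrite sum_O; apply pow2_ge_0.
  - rewrite sum_Sn; apply Rplus_le_le_0_compat; [exact IH|apply pow2_ge_0].
Qed.

Lemma mass_conj (x : nat -> C) (N : nat) :
  mass (fun j => Cconj (x j)) N = mass x N.
Proof. apply sum_n_ext; intros j; now rewrite Cmod_conj. Qed.

Lemma trig_poly_conj (x : nat -> C) (N : nat) (w : C) :
  Cconj (trig_poly x N w) = trig_poly (fun j => Cconj (x j)) N (Cconj w).
Proof.
  unfold trig_poly; rewrite Csum_conj; apply Csum_ext; intros j _.
  now rewrite Cmult_conj, Cpow_conj.
Qed.

Lemma sample_parseval (x : nat -> C) (N L : nat) :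
  (N <= L)%nat ->
  sum_n (fun l => Cmod (trig_poly x N (unit_root (S L) ^ l)%C) ^ 2) L
  = INR (S L) * mass x N.
Proof.
  intros HL; apply RtoC_inj; rewrite <- Csum_RtoC.
  set (node := fun l => (unit_root (S L) ^ l)%C).
  rewrite (Csum_ext _ (fun l => 1 * trig_poly x N (node l)
             * trig_poly (fun j => Cconj (x j)) N (Cconj (node l)))%C).
  2:{ intros l _; fold (node l).
      rewrite RtoC_pow.
      change (RtoC (Cmod (trig_poly x N (node l))) ^ 2)%C with
        (RtoC (Cmod (trig_poly x N (node l))) *
          (RtoC (Cmod (trig_poly x N (node l))) * 1))%C.
      rewrite Cmult_1_r, <- RtoC_mult.
      replace (Cmod (trig_poly x N (node l)) * Cmod (trig_poly x N (node l)))
        with (Cmod (trig_poly x N (node l)) ^ 2) by ring.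
      rewrite Cmod2_conj, trig_poly_conj; ring. }
  rewrite sample_expand, RtoC_mult; unfold mass.
  rewrite <- Csum_RtoC, <- Csum_mult_l.
  apply Csum_ext; intros i Hi.
  rewrite (Csum_unique_term _ N i Hi).
  - rewrite (Csum_ext _ (fun l => (node l) ^ i * Cconj (node l) ^ i)%C)
      by (intros; ring).
    unfold node; rewrite unit_root_orthogonality by lia.
    destruct (Nat.eq_dec i i); [|lia].
    rewrite Cmod2_conj; ring.
  - intros j Hj Hne.
    rewrite (Csum_ext _ (fun l => (node l) ^ j * Cconj (node l) ^ i)%C)
      by (intros; ring).
    unfold node; rewrite unit_root_orthogonality by lia.
    destruct (Nat.eq_dec j i); [lia|]; ring.
Qed.

(** At enough nodes the moments of [trig_poly b K] against [w ^ j] and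
    [conj w ^ i] are exactly the entries of the Toeplitz matrix; the bound
    [K + N <= L] is what excludes aliasing. *)
Lemma sample_toeplitz (b x y : nat -> C) (K N L : nat) :
  (N <= K)%nat -> (K + N <= L)%nat ->
  Csum (fun l => trig_poly b K (unit_root (S L) ^ l)
                 * trig_poly x N (unit_root (S L) ^ l)
                 * trig_poly y N (Cconj (unit_root (S L) ^ l)))%C L
  = (RtoC (INR (S L)) * toeplitz_form b x y N)%C.
Proof.
  intros HK HL.
  set (node := fun l => (unit_root (S L) ^ l)%C).
  rewrite (sample_expand node (fun l => trig_poly b K (node l))).
  unfold toeplitz_form; rewrite <- Csum_mult_l.
  apply Csum_ext; intros i Hi; rewrite <- Csum_mult_l.
  apply Csum_ext; intros j Hj.
  assert (E : Csum (fun l => trig_poly b K (node l)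
                 * (node l ^ j * Cconj (node l) ^ i))%C L
              = (RtoC (INR (S L)) * toeplitz_entry b i j)%C).
  { rewrite (Csum_ext _ (fun l => Csum (fun m =>
        b m * (node l ^ (m + j) * Cconj (node l) ^ i)) K)%C).
    2:{ intros l _; unfold trig_poly; rewrite <- Csum_mult_r.
        apply Csum_ext; intros m _; rewrite Cpow_add_r; ring. }
    rewrite Csum_switch.
    rewrite (Csum_ext _ (fun m => b m * (if Nat.eq_dec (m + j) i
               then RtoC (INR (S L)) else 0))%C).
    2:{ intros m Hm; rewrite Csum_mult_l; f_equal; unfold node.
        apply unit_root_orthogonality; lia. }
    unfold toeplitz_entry; destruct (Nat.leb_spec j i) as [Hji|Hji].
    - rewrite (Csum_unique_term _ K (i - j));
        [|lia|intros m _ Hm; destruct (Nat.eq_dec (m + j) i); [lia|ring]].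
      destruct (Nat.eq_dec (i - j + j) i); [ring|lia].
    - rewrite (Csum_unique_term _ K 0);
        [|lia|intros m _ Hm; destruct (Nat.eq_dec (m + j) i); [lia|ring]].
      destruct (Nat.eq_dec (0 + j) i); [lia|ring]. }
  rewrite E; ring.
Qed.

(** The form is an average of values of [trig_poly b K] times two factors whose
    mean squares are [mass x N] and [mass y N], so the arithmetic-geometric
    inequality at each node suffices. *)
Lemma toeplitz_form_poly_bound (b x y : nat -> C) (B : R) (K N : nat) :
  (N <= K)%nat ->
  (forall w : C, Cmod w = 1 -> Cmod (trig_poly b K w) <= B) ->
  Cmod (toeplitz_form b x y N) <= B * ((mass x N + mass y N) / 2).
Proof.
  intros HK HB.
  assert (HM : 0 < INR (S (K + N))) by (apply lt_0_INR; lia).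
  apply (Rmult_le_reg_l _ _ _ HM).
  rewrite <- (Rabs_pos_eq (INR _)) at 1 by lra.
  rewrite <- Cmod_R, <- Cmod_mult, <- (sample_toeplitz b x y K) by lia.
  eapply Rle_trans; [apply Cmod_Csum_le|].
  set (node := fun l => (unit_root (S (K + N)) ^ l)%C).
  apply Rle_trans with (sum_n (fun l => B / 2 *
     (Cmod (trig_poly x N (node l)) ^ 2
      + Cmod (trig_poly (fun i => Cconj (y i)) N (node l)) ^ 2)) (K + N)).
  - apply sum_n_Rle; intros l _; fold (node l).
    assert (Hy : Cmod (trig_poly y N (Cconj (node l)))
                 = Cmod (trig_poly (fun i => Cconj (y i)) N (node l))).
    { rewrite <- Cmod_conj, trig_poly_conj, Cconj_conj; reflexivity. }
    rewrite !Cmod_mult, Hy.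
    assert (Hn := HB (node l) (Cmod_unit_root_pow _ _)).
    assert (H0 := Cmod_ge_0 (trig_poly b K (node l))).
    assert (Hx0 := Cmod_ge_0 (trig_poly x N (node l))).
    assert (Hy0 := Cmod_ge_0 (trig_poly (fun i => Cconj (y i)) N (node l))).
    revert Hn H0 Hx0 Hy0; generalize (Cmod (trig_poly b K (node l))).
    generalize (Cmod (trig_poly x N (node l))).
    generalize (Cmod (trig_poly (fun i => Cconj (y i)) N (node l))).
    intros q p h Hh Hh0 Hp Hq.
    apply Rle_trans with (B * (p * q)).
    + rewrite Rmult_assoc; apply Rmult_le_compat_r; [nra|exact Hh].
    + assert (0 <= (p - q) ^ 2) by apply pow2_ge_0; nra.
  - rewrite (sum_n_mult_l (K := R_Ring)), (sum_n_plus (G := R_AbelianMonoid)).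
    unfold node; rewrite !sample_parseval by lia; rewrite mass_conj.
    apply Req_le; unfold mult, plus; simpl; field.
Qed.

(** * From polynomials to bounded power series *)

Lemma is_series_C_limit (u : nat -> C) (l : C) :
  @is_series C_AbsRing C_NormedModule u l ->
  forall eps : posreal, exists n0 : nat, forall n : nat, (n0 <= n)%nat ->
    Cmod (Csum u n - l)%C < eps.
Proof.
  intros H eps.
  destruct (proj1 (filterlim_locally_ball_norm (K := C_AbsRing)
    (U := C_NormedModule) (sum_n u) l) H eps) as [n0 Hn0].
  exists n0; intros n Hn; exact (Hn0 n Hn).
Qed.

Lemma is_series_C_intro (u : nat -> C) (l : C) :
  (forall eps : posreal, exists n0 : nat, forall n : nat, (n0 <= n)%nat ->
    Cmod (Csum u n - l)%C < eps) ->
  @is_series C_AbsRing C_NormedModule u l.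
Proof.
  intros H.
  apply (proj2 (filterlim_locally_ball_norm (K := C_AbsRing)
    (U := C_NormedModule) (F := eventually) (sum_n u) l)).
  intros eps; destruct (H eps) as [n0 Hn0].
  exists n0; intros n Hn; exact (Hn0 n Hn).
Qed.

Lemma is_series_C_terms_small (u : nat -> C) (l : C) :
  @is_series C_AbsRing C_NormedModule u l ->
  exists n0 : nat, forall n : nat, (n0 <= n)%nat -> Cmod (u n) <= 1.
Proof.
  intros H.
  destruct (is_series_C_limit u l H (mkposreal (1 / 2) ltac:(lra))) as [n0 Hn0].
  exists (S n0); intros [|n] Hn; [lia|].
  assert (H1 := Hn0 (S n) ltac:(lia)); assert (H2 := Hn0 n ltac:(lia)).
  simpl in H1, H2.
  replace (u (S n)) with ((Csum u (S n) - l) + - (Csum u n - l))%C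
    by (rewrite Csum_S; ring).
  eapply Rle_trans; [apply Cmod_triangle|]; rewrite Cmod_opp; lra.
Qed.

Lemma Cmod_Csum_tail_le (u : nat -> C) (q : R) (K n : nat) :
  0 <= q < 1 ->
  (forall m : nat, (K <= m)%nat -> Cmod (u m) <= q ^ m) ->
  (K <= n)%nat -> Cmod (Csum u n - Csum u K)%C <= (q ^ K - q ^ n) / (1 - q).
Proof.
  intros Hq Hu Hn; induction Hn as [|n Hn IH].
  - replace (Csum u K - Csum u K)%C with (RtoC 0) by ring.
    rewrite Cmod_0; apply Req_le; field; lra.
  - rewrite Csum_S.
    replace (Csum u n + u (S n) - Csum u K)%C
      with ((Csum u n - Csum u K) + u (S n))%C by ring.
    eapply Rle_trans; [apply Cmod_triangle|].
    assert (H1 := Hu (S n) ltac:(lia)).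
    assert (H2 : 0 <= q ^ n) by (apply pow_le; lra).
    apply Rle_trans with ((q ^ K - q ^ n) / (1 - q) + q ^ n).
    + simpl in H1; nra.
    + apply Req_le; simpl; field; lra.
Qed.

(** Convergence at a point [s] with [r < s < 1] bounds the terms on [|w| = r]
    by those of a geometric series.  Uniformity in [w] matters because the
    number of sampling nodes grows with [K]. *)
Lemma power_series_uniform_truncation (b : nat -> C) (k : nat) (g : C -> C) :
  (forall w : C, Cmod w < 1 ->
     @is_series C_AbsRing C_NormedModule (fun m => b m * w ^ (k + m))%C (g w)) ->
  forall (r eps : R) (N : nat), 0 < r < 1 -> 0 < eps ->
  exists K : nat, (N <= K)%nat /\
    forall w : C, Cmod w = r ->
      Cmod (Csum (fun m => b m * w ^ (k + m)) K - g w)%C <= eps.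
Proof.
  intros Hg r eps N Hr Heps.
  set (s := (1 + r) / 2); set (q := r / s).
  assert (Hs : r < s < 1) by (unfold s; lra).
  assert (Hq : 0 < q < 1).
  { unfold q; split; [apply Rdiv_lt_0_compat; lra|].
    apply Rlt_div_l; lra. }
  destruct (is_series_C_terms_small _ _ (Hg (RtoC s)
    ltac:(rewrite Cmod_R, Rabs_pos_eq; lra))) as [n0 Hn0].
  destruct (pow_lt_1_zero q ltac:(rewrite Rabs_pos_eq; lra)
    (eps / 2 * (1 - q)) ltac:(nra)) as [n1 Hn1].
  exists (max N (max n0 n1)); split; [lia|].
  set (K := max N (max n0 n1)); intros w Hw.
  assert (Hterm : forall m, (K <= m)%nat ->
            Cmod (b m * w ^ (k + m))%C <= q ^ m).
  { intros m Hm; assert (H := Hn0 m ltac:(lia)).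
    rewrite Cmod_mult, Cmod_pow in *.
    rewrite Cmod_R, Rabs_pos_eq in H by lra.
    rewrite Hw; replace r with (s * q) by (unfold q; field; lra).
    rewrite Rpow_mult_distr, <- Rmult_assoc.
    apply Rle_trans with (1 * q ^ (k + m)).
    - apply Rmult_le_compat_r; [apply pow_le; lra|exact H].
    - assert (q ^ k <= 1) by (rewrite <- (pow1 k); apply pow_incr; lra).
      assert (0 <= q ^ m) by (apply pow_le; lra).
      rewrite pow_add; nra. }
  destruct (is_series_C_limit _ _ (Hg w ltac:(lra))
    (mkposreal (eps / 2) ltac:(lra))) as [n2 Hn2]; simpl in Hn2.
  set (n := max K n2).
  assert (H1 := Hn2 n ltac:(lia)).
  assert (H2 := Cmod_Csum_tail_le (fun m => b m * w ^ (k + m))%C q K n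
                  ltac:(lra) Hterm ltac:(lia)).
  assert (H3 : (q ^ K - q ^ n) / (1 - q) <= eps / 2).
  { apply Rle_div_l; [lra|].
    assert (H3 := Hn1 K ltac:(lia)); rewrite Rabs_pos_eq in H3
      by (apply pow_le; lra).
    assert (0 <= q ^ n) by (apply pow_le; lra); lra. }
  set (SK := Csum _ K) in *; set (Sn := Csum _ n) in *.
  replace (SK - g w)%C with (- (Sn - SK) + (Sn - g w))%C by ring.
  eapply Rle_trans; [apply Cmod_triangle|]; rewrite Cmod_opp; lra.
Qed.

Lemma le_of_pow_mult_le (A E : R) (n : nat) :
  (forall r : R, 0 < r < 1 -> r ^ n * A <= E) -> A <= E.
Proof.
  intros H; apply Rnot_lt_le; intros Hlt.
  assert (Hlim : is_lim_seq (fun p => (1 - / (INR p + 2)) ^ n * A) (1 ^ n * A)).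
  { apply is_lim_seq_continuous
      with (f := fun t => t ^ n * A) (u := fun p => 1 - / (INR p + 2)).
    - apply continuity_pt_filterlim.
      apply (ex_derive_continuous (fun t : R => t ^ n * A)); auto_derive; auto.
    - replace (Finite 1) with (Finite (1 - 0)) by (f_equal; ring).
      apply is_lim_seq_minus'; [apply is_lim_seq_const|].
      replace (Finite 0) with (Rbar_inv p_infty) by reflexivity.
      apply is_lim_seq_inv; [|discriminate].
      apply is_lim_seq_plus with p_infty 2;
        [apply is_lim_seq_INR|apply is_lim_seq_const|reflexivity]. }
  rewrite pow1, Rmult_1_l in Hlim.
  assert (Hle : Rbar_le A E).
  { apply (is_lim_seq_le _ (fun _ => E) A E) with (2 := Hlim);
      [|apply is_lim_seq_const].
    intros p; apply H; assert (Hp := pos_INR p).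
    assert (0 < / (INR p + 2)) by (apply Rinv_0_lt_compat; lra).
    assert (/ (INR p + 2) < 1).
    { rewrite <- Rinv_1; apply Rinv_lt_contravar; lra. }
    lra. }
  simpl in Hle; lra.
Qed.

Lemma mass_le_scaled (x y : nat -> C) (t : R) (N : nat) :
  (forall j, (j <= N)%nat -> Cmod (x j) <= t * Cmod (y j)) ->
  mass x N <= t ^ 2 * mass y N.
Proof.
  intros H; unfold mass.
  rewrite <- (sum_n_mult_l (K := R_Ring) (t ^ 2)).
  apply sum_n_Rle; intros j Hj.
  change (Cmod (x j) ^ 2 <= t ^ 2 * Cmod (y j) ^ 2).
  rewrite <- Rpow_mult_distr; apply pow_incr; split; [apply Cmod_ge_0|auto].
Qed.

(** The matrix of the coefficients [b m * r ^ m] is the matrix of [b] conjugated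
    by the diagonal matrix of the [r ^ i].  The bound on the circle of radius
    [r] therefore transfers to [b] itself, up to powers of [r] that disappear
    as [r] tends to [1]. *)
Theorem toeplitz_form_bound (b : nat -> C) (k : nat) (g : C -> C) :
  (forall w : C, Cmod w < 1 ->
     @is_series C_AbsRing C_NormedModule (fun m => b m * w ^ (k + m))%C (g w)) ->
  (forall w : C, Cmod w < 1 -> Cmod (g w) <= 1) ->
  forall (x y : nat -> C) (N : nat),
  Cmod (toeplitz_form b x y N) <= (mass x N + mass y N) / 2.
Proof.
  intros Hg Hb x y N.
  set (E := (mass x N + mass y N) / 2).
  assert (HE : 0 <= E).
  { unfold E; assert (Hx := mass_nonneg x N); assert (Hy := mass_nonneg y N).
    lra. }
  apply (le_of_pow_mult_le _ _ (k + 2 * N)); intros r Hr.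
  assert (Hrk : 0 < r ^ k) by (apply pow_lt; lra).
  assert (HrN : 0 < r ^ N) by (apply pow_lt; lra).
  apply le_epsilon; intros eps Heps.
  destruct (power_series_uniform_truncation b k g Hg r (eps / (1 + E)) N Hr
    ltac:(apply Rdiv_lt_0_compat; lra)) as (K & HNK & HK).
  set (x' := fun j => (x j * r ^ j)%C).
  set (y' := fun i => (y i * (/ r) ^ i)%C).
  assert (Hform : toeplitz_form (fun m => b m * r ^ m)%C x' y' N
                  = toeplitz_form b x y N).
  { unfold toeplitz_form; apply Csum_ext; intros i _.
    apply Csum_ext; intros j _; unfold toeplitz_entry, x', y'.
    assert (Hr0 : RtoC r <> 0) by (intros Z; apply RtoC_inj in Z; lra).
    destruct (Nat.leb_spec j i) as [Hji|Hji]; [|ring].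
    replace ((/ r) ^ i)%C with ((/ r) ^ (i - j) * (/ r) ^ j)%C
      by (rewrite <- Cpow_add_r; f_equal; lia).
    rewrite !Cpow_inv by exact Hr0.
    field; split; apply Cpow_nz; exact Hr0. }
  rewrite <- Hform.
  assert (Hpoly : forall w, Cmod w = 1 ->
    Cmod (trig_poly (fun m => b m * r ^ m)%C K w)
      <= (1 + eps / (1 + E)) / r ^ k).
  { intros w Hw.
    assert (Hrw : Cmod (r * w)%C = r).
    { rewrite Cmod_mult, Cmod_R, Hw, Rabs_pos_eq; lra. }
    apply Rle_div_r; [exact Hrk|].
    replace (r ^ k) with (Cmod ((r * w) ^ k)%C)
      by (rewrite Cmod_pow, Hrw; reflexivity).
    rewrite <- Cmod_mult; unfold trig_poly; rewrite <- Csum_mult_r.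
    rewrite (Csum_ext _ (fun m => b m * (r * w) ^ (k + m))%C).
    2:{ intros m _; rewrite Cpow_add_r, !Cpow_mult_l; ring. }
    assert (H1 := HK (r * w)%C Hrw); assert (H2 := Hb (r * w)%C ltac:(lra)).
    set (SK := Csum _ K) in *.
    replace SK with ((SK - g (r * w)) + g (r * w))%C by ring.
    eapply Rle_trans; [apply Cmod_triangle|]; lra. }
  assert (HT := toeplitz_form_poly_bound _ x' y' _ K N HNK Hpoly).
  assert (Hx : mass x' N <= 1 ^ 2 * mass x N).
  { apply mass_le_scaled; intros j _; unfold x'.
    rewrite Cmod_mult, Cmod_pow, Cmod_R, Rabs_pos_eq by lra.
    rewrite Rmult_comm; apply Rmult_le_compat_r; [apply Cmod_ge_0|].
    rewrite <- (pow1 j); apply pow_incr; lra. }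
  assert (Hy : mass y' N <= (/ r ^ N) ^ 2 * mass y N).
  { apply mass_le_scaled; intros j Hj; unfold y'.
    assert (Hr0 : RtoC r <> 0) by (intros Z; apply RtoC_inj in Z; lra).
    rewrite Cmod_mult, Cmod_pow, Cmod_inv, Cmod_R, Rabs_pos_eq by (auto; lra).
    rewrite Rmult_comm; apply Rmult_le_compat_r; [apply Cmod_ge_0|].
    rewrite <- pow_inv; apply Rle_pow; [|exact Hj].
    rewrite <- Rinv_1; apply Rinv_le_contravar; lra. }
  assert (Hmx := mass_nonneg x N); assert (Hmy := mass_nonneg y N).
  assert (HrN1 : r ^ N <= 1) by (rewrite <- (pow1 N); apply pow_incr; lra).
  assert (Hmass : (r ^ N) ^ 2 * ((mass x' N + mass y' N) / 2) <= E).
  { apply (Rmult_le_compat_l ((r ^ N) ^ 2)) in Hx; [|apply pow2_ge_0].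
    apply (Rmult_le_compat_l ((r ^ N) ^ 2)) in Hy; [|apply pow2_ge_0].
    replace ((r ^ N) ^ 2 * ((/ r ^ N) ^ 2 * mass y N)) with (mass y N) in Hy
      by (field; lra).
    assert (Hsq : (r ^ N) ^ 2 <= 1) by nra.
    assert ((r ^ N) ^ 2 * (1 ^ 2 * mass x N) <= mass x N) by nra.
    unfold E; lra. }
  assert (Hpow : r ^ (k + 2 * N) = (r ^ N) ^ 2 * r ^ k).
  { rewrite pow_add, Nat.mul_comm, pow_mult; ring. }
  rewrite Hpow.
  apply Rle_trans with ((r ^ N) ^ 2 * r ^ k
    * ((1 + eps / (1 + E)) / r ^ k * ((mass x' N + mass y' N) / 2))).
  { apply Rmult_le_compat_l; [|exact HT].
    apply Rmult_le_pos; [apply pow2_ge_0|lra]. }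
  replace ((r ^ N) ^ 2 * r ^ k
    * ((1 + eps / (1 + E)) / r ^ k * ((mass x' N + mass y' N) / 2)))
    with ((1 + eps / (1 + E)) * ((r ^ N) ^ 2 * ((mass x' N + mass y' N) / 2)))
    by (field; lra).
  apply Rle_trans with ((1 + eps / (1 + E)) * E).
  - apply Rmult_le_compat_l; [|exact Hmass].
    assert (0 < eps / (1 + E)) by (apply Rdiv_lt_0_compat; lra); lra.
  - assert (Hfrac : eps / (1 + E) * E <= eps).
    { replace (eps / (1 + E) * E) with (eps - eps / (1 + E)) by (field; lra).
      assert (0 < eps / (1 + E)) by (apply Rdiv_lt_0_compat; lra); lra. }
    lra.
Qed.

(** * Coefficient inequalities *)

(** The value at [2 * i = N] minimizes [(1 + a) t ^ 2 - 2 t] over real [t]. *)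
Definition carlson_weight (a : R) (N i : nat) : R :=
  match Nat.compare (2 * i) N with
  | Lt => 1
  | Eq => / (1 + a)
  | Gt => 0
  end.

Definition unit_vector (p j : nat) : C := if Nat.eqb j p then 1 else 0.

Lemma toeplitz_form_plus_x (b x1 x2 y : nat -> C) (N : nat) :
  toeplitz_form b (fun j => x1 j + x2 j)%C y N
  = (toeplitz_form b x1 y N + toeplitz_form b x2 y N)%C.
Proof.
  unfold toeplitz_form; rewrite <- Csum_plus; apply Csum_ext; intros i _.
  rewrite <- Csum_plus; apply Csum_ext; intros j _; ring.
Qed.

Lemma toeplitz_form_plus_y (b x y1 y2 : nat -> C) (N : nat) :
  toeplitz_form b x (fun i => y1 i + y2 i)%C N
  = (toeplitz_form b x y1 N + toeplitz_form b x y2 N)%C.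
Proof.
  unfold toeplitz_form; rewrite <- Csum_plus; apply Csum_ext; intros i _.
  rewrite <- Csum_plus; apply Csum_ext; intros j _; ring.
Qed.

Lemma toeplitz_form_first_column (b y : nat -> C) (N : nat) :
  toeplitz_form b (unit_vector 0) y N = Csum (fun i => y i * b i)%C N.
Proof.
  apply Csum_ext; intros i _.
  rewrite (Csum_unique_term _ N 0); [|lia|].
  - unfold toeplitz_entry, unit_vector; simpl; rewrite Nat.sub_0_r; ring.
  - intros j _ Hj; unfold unit_vector.
    apply Nat.eqb_neq in Hj; rewrite Hj; ring.
Qed.

Lemma toeplitz_form_last_row (b x : nat -> C) (N : nat) :
  toeplitz_form b x (unit_vector N) N = Csum (fun j => b (N - j)%nat * x j)%C N.
Proof.
  unfold toeplitz_form; rewrite (Csum_unique_term _ N N); [|lia|].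
  - apply Csum_ext; intros j Hj; unfold toeplitz_entry, unit_vector.
    rewrite Nat.eqb_refl; apply Nat.leb_le in Hj; rewrite Hj; ring.
  - intros i _ Hi; rewrite (Csum_unique_term _ N 0); [|lia|];
      unfold unit_vector; apply Nat.eqb_neq in Hi; rewrite Hi; intros; ring.
Qed.

Lemma mass_add_unit_vector (x : nat -> C) (N p : nat) :
  (p <= N)%nat -> x p = 0 ->
  mass (fun j => unit_vector p j + x j)%C N = 1 + mass x N.
Proof.
  intros Hp Hx; unfold mass.
  rewrite (sum_n_ext _ (fun j => plus (if Nat.eqb j p then 1 else 0)
                                      (Cmod (x j) ^ 2))).
  - rewrite (sum_n_plus (G := R_AbelianMonoid)).
    rewrite (sum_n_unique_term (G := R_AbelianMonoid)
               (fun j => if Nat.eqb j p then 1 else 0) N p Hp).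
    + now rewrite Nat.eqb_refl.
    + intros i _ Hi; apply Nat.eqb_neq in Hi; now rewrite Hi.
  - intros j; unfold unit_vector, plus; simpl.
    destruct (Nat.eqb_spec j p) as [->|_].
    + rewrite Hx, Cplus_0_r, Cmod_1, Cmod_0; ring.
    + rewrite Cplus_0_l; ring.
Qed.

Lemma Cmod_phase (z : C) : exists phi : C, Cmod phi = 1 /\ z = (phi * Cmod z)%C.
Proof.
  destruct (Req_dec (Cmod z) 0) as [H|H].
  - exists (RtoC 1); split; [apply Cmod_1|].
    rewrite H, (Cmod_eq_0 z H); ring.
  - assert (Hz : RtoC (Cmod z) <> 0) by (intros Z; apply H, RtoC_inj, Z).
    exists (z / Cmod z)%C; split; [|field; exact Hz].
    rewrite Cmod_div, Cmod_R, Rabs_pos_eq by (auto using Cmod_ge_0).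
    field; exact H.
Qed.

(** The form is tested on [x = e_0 + v'] and [y = e_N + v], where [v] consists of
    weighted conjugates of the [b i] in the first half of the index range and
    [v'] is [v] reversed.  The pair [(e_0, e_N)] contributes [b N], the two mixed
    pairs contribute the same weighted sum of [|b i| ^ 2] each, and [v], [v']
    interact only at the middle index, through [b 0]. *)
Theorem carlson_inequality (b : nat -> C) :
  (forall (x y : nat -> C) (N : nat),
     Cmod (toeplitz_form b x y N) <= (mass x N + mass y N) / 2) ->
  forall N : nat, (1 <= N)%nat ->
  Cmod (b N) + sum_n (fun i => carlson_weight (Cmod (b O)) N i
                               * Cmod (b i) ^ 2) N <= 1.
Proof.
  intros H N HN; set (a := Cmod (b O)).
  assert (Ha : 0 <= a) by apply Cmod_ge_0.
  destruct (Cmod_phase (b N)) as (phi & Hphi & HbN).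
  set (w := carlson_weight a N).
  set (v := fun i => (w i * phi * Cconj (b i))%C).
  set (v' := fun j => v (N - j)%nat).
  (* As [1 <= N], [v] vanishes where [e_N] lives, and [v'] where [e_0] does. *)
  assert (HwN : w N = 0).
  { unfold w, carlson_weight.
    destruct (Nat.compare_spec (2 * N) N); [lia|lia|reflexivity]. }
  assert (HvN : v N = 0) by (unfold v; rewrite HwN; ring).
  assert (Hv : forall i, Cmod (v i) ^ 2 = w i ^ 2 * Cmod (b i) ^ 2).
  { intros i; unfold v.
    rewrite !Cmod_mult, Hphi, Cmod_conj, Cmod_R, Rmult_1_r, Rpow_mult_distr.
    now rewrite pow2_abs. }
  set (W := sum_n (fun i => w i * Cmod (b i) ^ 2) N).
  assert (HvW : Csum (fun i => v i * b i)%C N = (phi * W)%C).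
  { unfold W; rewrite <- Csum_RtoC, <- Csum_mult_l.
    apply Csum_ext; intros i _; rewrite RtoC_mult, Cmod2_conj; unfold v; ring. }
  assert (HB := H (fun j => unit_vector 0 j + v' j)%C
                  (fun i => unit_vector N i + v i)%C N).
  rewrite !mass_add_unit_vector in HB;
    [|lia|exact HvN|lia|unfold v'; rewrite Nat.sub_0_r; exact HvN].
  assert (Hrev : mass v' N = mass v N)
    by exact (sum_n_rev (G := R_AbelianMonoid) (fun j => Cmod (v j) ^ 2) N).
  rewrite Hrev in HB.
  rewrite toeplitz_form_plus_x, toeplitz_form_first_column in HB.
  rewrite toeplitz_form_plus_y, toeplitz_form_last_row in HB.
  rewrite (Csum_ext _ (fun i => unit_vector N i * b i + v i * b i)%C) in HB
    by (intros; ring).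
  rewrite Csum_plus, HvW in HB.
  rewrite (Csum_unique_term (fun i => unit_vector N i * b i)%C N N) in HB;
    [|lia|intros i _ Hi; unfold unit_vector; apply Nat.eqb_neq in Hi;
          rewrite Hi; ring].
  assert (HvW' : Csum (fun j => b (N - j)%nat * v' j)%C N = (phi * W)%C).
  { unfold v'; rewrite (Csum_rev (fun i => b i * v i)%C), <- HvW.
    apply Csum_ext; intros; ring. }
  rewrite HvW' in HB.
  (* Nonzero entries of [v] and [v'] have [2 i <= N <= 2 j], and the matrix is
     lower triangular: only [i = j = N / 2] survives. *)
  set (D := fun i => if Nat.eqb (2 * i) N then a * Cmod (v i) ^ 2 else 0).
  assert (HD : Cmod (toeplitz_form b v' v N) <= sum_n D N).
  { eapply Rle_trans; [apply Cmod_Csum_le|].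
    apply sum_n_Rle; intros i Hi.
    rewrite (Csum_unique_term _ N i Hi).
    - unfold D, v'; destruct (Nat.eqb_spec (2 * i) N) as [E|E].
      + replace (N - i)%nat with i by lia.
        unfold toeplitz_entry; rewrite Nat.leb_refl, Nat.sub_diag.
        rewrite !Cmod_mult; fold a; apply Req_le; ring.
      + assert (Hz : (v i * v (N - i)%nat)%C = 0).
        { unfold v, w, carlson_weight.
          destruct (Nat.compare_spec (2 * i) N);
            destruct (Nat.compare_spec (2 * (N - i)) N); try lia; ring. }
        replace (v i * toeplitz_entry b i i * v (N - i)%nat)%C
          with (toeplitz_entry b i i * (v i * v (N - i)%nat))%C by ring.
        rewrite Hz, Cmult_0_r, Cmod_0; lra.
    - intros j Hj Hne; unfold toeplitz_entry, v', v, w, carlson_weight.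
      destruct (Nat.leb_spec j i); [|ring].
      destruct (Nat.compare_spec (2 * i) N);
        destruct (Nat.compare_spec (2 * (N - j)) N); try lia; ring. }
  (* Completing the square: [w ^ 2 + a w ^ 2 = w] at the middle index. *)
  assert (Hsum : mass v N + sum_n D N = W).
  { unfold mass, W; rewrite <- (sum_n_plus (G := R_AbelianMonoid)).
    apply sum_n_ext; intros i; rewrite Hv.
    change (w i ^ 2 * Cmod (b i) ^ 2 + D i = w i * Cmod (b i) ^ 2).
    unfold D; rewrite Hv; unfold w, carlson_weight.
    destruct (Nat.compare_spec (2 * i) N) as [E|E|E];
      destruct (Nat.eqb_spec (2 * i) N); try lia; field; lra. }
  assert (Hlow : Cmod (b N) + 2 * W
            <= Cmod (unit_vector N N * b N + phi * W
                 + (phi * W + toeplitz_form b v' v N))%C + sum_n D N).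
  { assert (Hpos : Cmod (b N) + 2 * W <= Cmod (phi * (Cmod (b N) + 2 * W))%C).
    { rewrite Cmod_mult, Hphi, Rmult_1_l, <- RtoC_mult, <- RtoC_plus, Cmod_R.
      apply Rle_abs. }
    eapply Rle_trans; [exact Hpos|].
    apply Rle_trans with (2 := Rplus_le_compat_l _ _ _ HD).
    rewrite <- (Cmod_opp (toeplitz_form b v' v N)).
    eapply Rle_trans; [|apply Cmod_triangle].
    apply Req_le; f_equal; unfold unit_vector; rewrite Nat.eqb_refl.
    rewrite HbN at 2; ring. }
  change (Cmod (b N) + W <= 1); lra.
Qed.

(** * Summing the coefficient inequalities *)

Definition bohr_weight (a rho : R) : R := / (1 + a) + rho / (1 - rho).

Definition bohr_majorant (k : nat) (a rho : R) : R :=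
  rho ^ k * (a + a ^ 2 / (1 + a) + rho / (1 - rho)).

Lemma carlson_weight_nonneg (a : R) (N i : nat) :
  0 <= a -> 0 <= carlson_weight a N i.
Proof.
  intros Ha; unfold carlson_weight; destruct Nat.compare; try lra.
  apply Rlt_le, Rinv_0_lt_compat; lra.
Qed.

(** Inequality [N = 2 i] contributes the first part of [bohr_weight], the
    inequalities with [N > 2 i] a geometric tail. *)
Lemma carlson_weight_generating_series (a rho : R) (i : nat) :
  0 <= a -> 0 < rho < 1 ->
  is_series (fun N => carlson_weight a N i * rho ^ N)
            (rho ^ (2 * i) * bohr_weight a rho).
Proof.
  intros Ha Hrho.
  apply (is_series_decr_n (V := R_NormedModule) _ (S (2 * i))); [lia|].
  rewrite Nat.pred_succ.
  rewrite (sum_n_unique_term (G := R_AbelianMonoid) _ (2 * i) (2 * i)); [|lia|].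
  - apply (is_series_ext (V := R_NormedModule)
             (fun m => rho ^ S (2 * i) * rho ^ m)).
    { intros m; rewrite <- pow_add; unfold carlson_weight.
      destruct (Nat.compare_spec (2 * i) (S (2 * i) + m)); [lia| |lia].
      now rewrite Rmult_1_l. }
    replace (plus _ _) with (rho ^ S (2 * i) * / (1 - rho)).
    { apply (is_series_scal_l (V := R_NormedModule) (rho ^ S (2 * i))).
      apply is_series_geom; rewrite Rabs_pos_eq; lra. }
    unfold carlson_weight; rewrite Nat.compare_refl.
    change (rho ^ S (2 * i) * / (1 - rho)
            = rho ^ (2 * i) * bohr_weight a rho - / (1 + a) * rho ^ (2 * i)).
    unfold bohr_weight; rewrite <- tech_pow_Rmult; field; lra.
  - intros N HN Hne; unfold carlson_weight.
    destruct (Nat.compare_spec (2 * i) N); [lia|lia|].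
    apply Rmult_0_l.
Qed.

Lemma sum_n_le_of_support (u : nat -> R) (n p : nat) :
  (forall i, 0 <= u i) -> (forall i, (p < i)%nat -> u i = 0) ->
  sum_n u n <= sum_n u p.
Proof.
  intros Hpos Hsup; destruct (Nat.le_ge_cases n p) as [H|H].
  - induction H as [|p H IH]; [lra|].
    assert (Hstep : forall q, sum_n u q <= sum_n u (S q)).
    { intros q; rewrite sum_Sn; assert (H0 := Hpos (S q)).
      unfold plus; simpl; lra. }
    clear IH Hsup; induction H as [|p H IH]; [apply Hstep|].
    apply Rle_trans with (1 := IH); apply Hstep.
  - induction H as [|n H IH]; [lra|].
    rewrite sum_Sn, (Hsup (S n)) by lia; unfold plus; simpl; lra.
Qed.

Lemma is_series_sum_n (u : nat -> nat -> R) (l : nat -> R) (n : nat) :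
  (forall i, is_series (u i) (l i)) ->
  is_series (fun N => sum_n (fun i => u i N) n) (sum_n l n).
Proof.
  intros H; induction n as [|n IH].
  - rewrite sum_O; apply (is_series_ext (u O)); [|apply H].
    intros N; now rewrite sum_O.
  - rewrite sum_Sn.
    apply (is_series_ext (fun N => plus (sum_n (fun i => u i N) n) (u (S n) N))).
    + intros N; now rewrite sum_Sn.
    + now apply (is_series_plus (V := R_NormedModule)).
Qed.

Lemma ex_series_bounded_geom (u : nat -> R) (q : R) :
  0 <= q < 1 -> (forall n, 0 <= u n <= 1) -> ex_series (fun n => u n * q ^ n).
Proof.
  intros Hq Hu.
  apply (ex_series_le (V := R_CompleteNormedModule) _ (fun n => q ^ n)).
  - intros n; destruct (Hu n) as [H0 H1].
    assert (Hp : 0 <= q ^ n) by (apply pow_le; lra).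
    change (Rabs (u n * q ^ n) <= q ^ n); rewrite Rabs_pos_eq; nra.
  - exists (/ (1 - q)); apply is_series_geom; rewrite Rabs_pos_eq; lra.
Qed.

(** The sum over [i] is first cut at a fixed [I], so that the double series
    splits into finitely many series in [N]; then [I] tends to infinity. *)
Lemma refined_bohr_inequality (b : nat -> C) (rho : R) :
  (forall N : nat, (1 <= N)%nat ->
    Cmod (b N) + sum_n (fun i => carlson_weight (Cmod (b O)) N i
                                 * Cmod (b i) ^ 2) N <= 1) ->
  0 < rho < 1 ->
  ex_series (fun m => Cmod (b m) * rho ^ m) /\
  ex_series (fun m => Cmod (b m) ^ 2 * (rho ^ 2) ^ m) /\
  Series (fun m => Cmod (b m) * rho ^ m)
  + bohr_weight (Cmod (b O)) rho * Series (fun m => Cmod (b m) ^ 2 * (rho ^ 2) ^ m)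
  <= bohr_majorant 0 (Cmod (b O)) rho.
Proof.
  intros Hc Hrho; set (a := Cmod (b O)) in *.
  assert (Ha : 0 <= a) by apply Cmod_ge_0.
  set (w := carlson_weight a) in *.
  assert (Hw : forall N i, 0 <= w N i * Cmod (b i) ^ 2).
  { intros N i; apply Rmult_le_pos; [now apply carlson_weight_nonneg|].
    apply pow2_ge_0. }
  assert (Hpartial : forall N I, (1 <= N)%nat ->
            Cmod (b N) + sum_n (fun i => w N i * Cmod (b i) ^ 2) I <= 1).
  { intros N I HN; apply Rle_trans with (2 := Hc N HN), Rplus_le_compat_l.
    apply sum_n_le_of_support; [apply Hw|].
    intros i Hi; unfold w, carlson_weight.
    destruct (Nat.compare_spec (2 * i) N); [lia|lia|ring]. }
  assert (Hb1 : forall N, 0 <= Cmod (b N) <= 1).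
  { intros [|N]; (split; [apply Cmod_ge_0|]).
    - assert (H1 := Hpartial 1%nat 0%nat ltac:(lia)); rewrite sum_O in H1.
      unfold w, carlson_weight in H1; simpl Nat.compare in H1; cbv iota in H1.
      fold a in H1 |- *; assert (H0 := Cmod_ge_0 (b 1%nat)); nra.
    - assert (H1 := Hpartial (S N) 0%nat ltac:(lia)); rewrite sum_O in H1.
      assert (H0 := Hw (S N) 0%nat); lra. }
  assert (Hex1 : ex_series (fun m => Cmod (b m) * rho ^ m)).
  { apply ex_series_bounded_geom; [lra|exact Hb1]. }
  assert (Hex2 : ex_series (fun m => Cmod (b m) ^ 2 * (rho ^ 2) ^ m)).
  { apply ex_series_bounded_geom; [nra|].
    intros n; destruct (Hb1 n); nra. }
  split; [exact Hex1|split; [exact Hex2|]].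
  (* For [N = 0] the weighted sum equals [T 0], which may exceed [1]. *)
  set (T := fun N => match N with O => a + a ^ 2 / (1 + a) | _ => rho ^ N end).
  assert (HT : is_series T (bohr_majorant 0 a rho)).
  { apply (is_series_decr_1 (V := R_NormedModule)).
    apply (is_series_ext (fun n => rho * rho ^ n)); [intros n; reflexivity|].
    replace (plus _ _) with (rho * / (1 - rho)).
    - apply (is_series_scal_l (V := R_NormedModule) rho).
      apply is_series_geom; rewrite Rabs_pos_eq; lra.
    - change (rho * / (1 - rho)
              = bohr_majorant 0 a rho - (a + a ^ 2 / (1 + a))).
      unfold bohr_majorant; simpl pow; field; lra. }
  assert (Hfin : forall I, Series (fun m => Cmod (b m) * rho ^ m)
     + sum_n (fun i => bohr_weight a rho * (Cmod (b i) ^ 2 * (rho ^ 2) ^ i)) I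
     <= bohr_majorant 0 a rho).
  { intros I.
    assert (HS := is_series_sum_n
      (fun i N => Cmod (b i) ^ 2 * (w N i * rho ^ N)) _ I
      (fun i => is_series_scal_l (V := R_NormedModule) (Cmod (b i) ^ 2) _ _
                  (carlson_weight_generating_series a rho i Ha Hrho))).
    assert (HP := is_series_plus _ _ _ _ (Series_correct _ Hex1) HS).
    rewrite (sum_n_ext _ (fun i => Cmod (b i) ^ 2
               * (rho ^ (2 * i) * bohr_weight a rho))).
    2:{ intros i; rewrite pow_mult.
        eq_in R; ring. }
    rewrite <- (is_series_unique _ _ HT).
    match type of HP with is_series ?s ?l =>
      change (l <= Series T); rewrite <- (is_series_unique s l HP) end.
    apply Series_le; [|exists (bohr_majorant 0 a rho); exact HT].
    intros N.
    assert (Hp : 0 < rho ^ N) by (apply pow_lt; lra).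
    match goal with |- 0 <= ?t <= _ =>
      replace t with ((Cmod (b N)
        + sum_n (fun i => w N i * Cmod (b i) ^ 2) I) * rho ^ N) end.
    2:{ rewrite Rmult_plus_distr_r.
        apply (f_equal (Rplus (Cmod (b N) * rho ^ N))).
        rewrite <- (sum_n_mult_r (K := R_Ring) (rho ^ N)).
        apply sum_n_ext; intros i.
        change (w N i * Cmod (b i) ^ 2 * rho ^ N
                = Cmod (b i) ^ 2 * (w N i * rho ^ N)); ring. }
    assert (H0 : 0 <= sum_n (fun i => w N i * Cmod (b i) ^ 2) I).
    { clear - Hw; induction I as [|I IH].
      - rewrite sum_O; apply Hw.
      - rewrite sum_Sn; apply Rplus_le_le_0_compat; [exact IH|apply Hw]. }
    split.
    - apply Rmult_le_pos; [|lra]; destruct (Hb1 N); lra.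
    - destruct N as [|N]; unfold T.
      + rewrite pow_O, Rmult_1_r; apply Rplus_le_compat_l.
        eapply Rle_trans; [apply (sum_n_le_of_support _ I 0); [apply Hw|]|].
        * intros i Hi; unfold w, carlson_weight.
          destruct (Nat.compare_spec (2 * i) 0); [lia|lia|ring].
        * rewrite sum_O; apply Req_le; unfold w, carlson_weight; simpl.
          fold a; field; lra.
      + rewrite <- (Rmult_1_l (rho ^ S N)) at 2.
        apply Rmult_le_compat_r; [lra|apply Hpartial; lia]. }
  assert (Hlim : is_lim_seq
    (sum_n (fun i => bohr_weight a rho * (Cmod (b i) ^ 2 * (rho ^ 2) ^ i)))
    (bohr_weight a rho * Series (fun m => Cmod (b m) ^ 2 * (rho ^ 2) ^ m))).
  { apply (is_series_scal_l (V := R_NormedModule) (bohr_weight a rho)).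
    now apply Series_correct. }
  assert (Hle : Rbar_le
    (bohr_weight a rho * Series (fun m => Cmod (b m) ^ 2 * (rho ^ 2) ^ m))
    (bohr_majorant 0 a rho - Series (fun m => Cmod (b m) * rho ^ m))).
  { apply (is_lim_seq_le _ (fun _ => bohr_majorant 0 a rho
             - Series (fun m => Cmod (b m) * rho ^ m))) with (2 := Hlim);
      [|apply is_lim_seq_const].
    intros I; assert (HI := Hfin I); lra. }
  unfold Rbar_le in Hle; lra.
Qed.

(** * The equation for the radius *)

Lemma radius_polynomial_eq (k : nat) (a r : R) :
  0 <= a -> r < 1 ->
  (2 * a ^ 2 - 1) * r ^ (k + 1) - a * (1 + 2 * a) * r ^ k - (1 + a) * r + 1 + a
  = (1 + a) * (1 - r) * (1 - bohr_majorant k a r).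
Proof.
  intros Ha Hr; unfold bohr_majorant; rewrite pow_add, pow_1; field; lra.
Qed.

(** On [(0, 1)] the defining polynomial is a positive multiple of
    [1 - bohr_majorant k a r]. *)
Lemma is_rho_iff (k : nat) (a r : R) :
  0 <= a -> is_rho k a r <-> 0 < r < 1 /\ bohr_majorant k a r = 1.
Proof.
  intros Ha; unfold is_rho.
  split; intros [Hr H]; (split; [exact Hr|]).
  - rewrite radius_polynomial_eq in H by lra.
    apply Rmult_integral in H; destruct H as [H|H]; [|lra].
    apply Rmult_integral in H; lra.
  - rewrite radius_polynomial_eq, H by lra; ring.
Qed.

Lemma bohr_majorant_increasing (k : nat) (a r s : R) :
  0 <= a -> 0 < r < s -> s < 1 -> bohr_majorant k a r < bohr_majorant k a s.
Proof.
  intros Ha Hr Hs; unfold bohr_majorant.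
  assert (Hk : r ^ k <= s ^ k) by (apply pow_incr; lra).
  assert (Hk0 : 0 < r ^ k) by (apply pow_lt; lra).
  assert (Hc : 0 <= a ^ 2 / (1 + a)).
  { apply Rmult_le_pos; [apply pow2_ge_0|].
    apply Rlt_le, Rinv_0_lt_compat; lra. }
  assert (Hd : 0 < r / (1 - r)) by (apply Rdiv_lt_0_compat; lra).
  assert (Hd' : r / (1 - r) < s / (1 - s)).
  { apply Rminus_lt_0.
    replace (s / (1 - s) - r / (1 - r)) with ((s - r) / ((1 - s) * (1 - r)))
      by (field; lra).
    apply Rdiv_lt_0_compat; nra. }
  apply Rlt_le_trans with (r ^ k * (a + a ^ 2 / (1 + a) + s / (1 - s))).
  - apply Rmult_lt_compat_l; lra.
  - apply Rmult_le_compat_r; lra.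
Qed.

Lemma is_rho_exists_unique (k : nat) (a : R) :
  0 <= a -> ((1 <= k)%nat \/ 2 * a ^ 2 < 1) -> exists! r : R, is_rho k a r.
Proof.
  intros Ha Hk.
  set (P := fun r => - ((2 * a ^ 2 - 1) * r ^ (k + 1)
              - a * (1 + 2 * a) * r ^ k - (1 + a) * r + 1 + a)).
  assert (HP : continuity P).
  { intros r; apply continuity_pt_filterlim.
    apply (ex_derive_continuous P); unfold P; auto_derive; auto. }
  assert (HP0 : P 0 < 0).
  { unfold P; rewrite Nat.add_1_r; destruct k as [|k].
    - destruct Hk as [Hk|Hk]; [lia|]; simpl in *; nra.
    - rewrite !pow_ne_zero by lia; lra. }
  assert (HP1 : 0 < P 1) by (unfold P; rewrite !pow1; nra).
  destruct (IVT P 0 1 HP ltac:(lra) HP0 HP1) as (r & Hr & HPr).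
  assert (Hroot : is_rho k a r).
  { split; [|unfold P in HPr; lra].
    split; apply Rnot_le_lt; intros Hle.
    - replace r with 0 in HPr by lra; lra.
    - replace r with 1 in HPr by lra; lra. }
  exists r; split; [exact Hroot|]; intros s Hs.
  apply is_rho_iff in Hroot, Hs; try exact Ha.
  destruct (Rtotal_order r s) as [H|[H|H]]; [|exact H|].
  - assert (H' := bohr_majorant_increasing k a r s Ha ltac:(lra) ltac:(lra)); lra.
  - assert (H' := bohr_majorant_increasing k a s r Ha ltac:(lra) ltac:(lra)); lra.
Qed.

(** * Reduction to the unit disk *)

Definition disk_coeff (gamma : R) (k : nat) (c : nat -> C) (m : nat) : C :=
  (c (k + m)%nat / RtoC ((1 - gamma) ^ (k + m)))%C.

Lemma Cmod_disk_coeff (gamma : R) (k : nat) (c : nat -> C) (m : nat) :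
  gamma < 1 ->
  Cmod (disk_coeff gamma k c m) = Cmod (c (k + m)%nat) / (1 - gamma) ^ (k + m).
Proof.
  intros Hg; unfold disk_coeff.
  assert (Hp : 0 < (1 - gamma) ^ (k + m)) by (apply pow_lt; lra).
  rewrite Cmod_div, Cmod_R, Rabs_pos_eq; [reflexivity|lra|].
  intros Z; apply RtoC_inj in Z; lra.
Qed.

Lemma lead_eq (gamma : R) (k : nat) (c : nat -> C) :
  gamma < 1 -> lead gamma k c = Cmod (disk_coeff gamma k c 0).
Proof.
  intros Hg; rewrite Cmod_disk_coeff, Nat.add_0_r by exact Hg; reflexivity.
Qed.

Lemma major_term_eq (gamma : R) (k : nat) (c : nat -> C) (rho : R) (m : nat) :
  gamma < 1 ->
  major_term gamma k c rho m
  = rho ^ k * (Cmod (disk_coeff gamma k c m) * rho ^ m).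
Proof.
  intros Hg; unfold major_term; rewrite Cmod_disk_coeff, (pow_add rho) by exact Hg.
  ring.
Qed.

Lemma norm_term_eq (gamma : R) (k : nat) (c : nat -> C) (rho : R) (m : nat) :
  gamma < 1 ->
  norm_term gamma k c rho m
  = rho ^ (2 * k) * (Cmod (disk_coeff gamma k c m) ^ 2 * (rho ^ 2) ^ m).
Proof.
  intros Hg; unfold norm_term; rewrite Cmod_disk_coeff by exact Hg.
  assert (Hp : 0 < (1 - gamma) ^ (k + m)) by (apply pow_lt; lra).
  rewrite <- (pow_mult rho), (Nat.mul_add_distr_l 2 k m), (pow_add rho).
  rewrite <- (Nat.mul_add_distr_l 2 k m), (Nat.mul_comm 2 (k + m)), pow_mult.
  field; lra.
Qed.

Lemma bohr_summable_intro (gamma : R) (k : nat) (c : nat -> C) (rho : R) :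
  gamma < 1 ->
  ex_series (fun m => Cmod (disk_coeff gamma k c m) * rho ^ m) ->
  ex_series (fun m => Cmod (disk_coeff gamma k c m) ^ 2 * (rho ^ 2) ^ m) ->
  bohr_summable gamma k c rho.
Proof.
  intros Hg H1 H2; split.
  - apply (ex_series_ext (V := R_NormedModule) (fun m => scal (rho ^ k)
             (Cmod (disk_coeff gamma k c m) * rho ^ m))).
    + intros m; now rewrite major_term_eq.
    + now apply (ex_series_scal_l (V := R_NormedModule)).
  - apply (ex_series_ext (V := R_NormedModule) (fun m => scal (rho ^ (2 * k))
             (Cmod (disk_coeff gamma k c m) ^ 2 * (rho ^ 2) ^ m))).
    + intros m; now rewrite norm_term_eq.
    + now apply (ex_series_scal_l (V := R_NormedModule)).
Qed.

Lemma bohr_lhs_eq (gamma : R) (k : nat) (c : nat -> C) (rho : R) :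
  gamma < 1 -> 0 < rho < 1 ->
  bohr_lhs gamma k c rho
  = rho ^ k * (Series (fun m => Cmod (disk_coeff gamma k c m) * rho ^ m)
      + bohr_weight (lead gamma k c) rho
        * Series (fun m => Cmod (disk_coeff gamma k c m) ^ 2 * (rho ^ 2) ^ m)).
Proof.
  intros Hg Hrho; unfold bohr_lhs, norm_sq.
  rewrite (Series_ext _ _ (fun m => major_term_eq gamma k c rho m Hg)).
  rewrite (Series_ext _ _ (fun m => norm_term_eq gamma k c rho m Hg)).
  rewrite !Series_scal_l.
  assert (Hl : 0 <= lead gamma k c).
  { rewrite lead_eq by exact Hg; apply Cmod_ge_0. }
  assert (Hp : 0 < rho ^ k) by (apply pow_lt; lra).
  replace (1 - Z.of_nat k)%Z with (1 + - Z.of_nat k)%Z by lia.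
  rewrite powerRZ_add, powerRZ_1, powerRZ_neg', <- pow_powerRZ by lra.
  rewrite (Nat.mul_comm 2 k), pow_mult.
  unfold bohr_weight; field; lra.
Qed.

Lemma Omega_of_disk (gamma : R) (w : C) :
  0 <= gamma < 1 -> Cmod w < 1 ->
  Omega gamma (RtoC (center gamma) + w / RtoC (1 - gamma))%C.
Proof.
  intros Hg Hw.
  assert (Hnz : RtoC (1 - gamma) <> 0) by (intros Z; apply RtoC_inj in Z; lra).
  unfold Omega.
  replace (RtoC (center gamma) + w / RtoC (1 - gamma) - RtoC (center gamma))%C
    with (w / RtoC (1 - gamma))%C by ring.
  rewrite Cmod_div, Cmod_R, Rabs_pos_eq by (auto; lra).
  apply Rmult_lt_compat_r; [apply Rinv_0_lt_compat; lra|exact Hw].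
Qed.

Lemma has_expansion_disk (gamma : R) (k : nat) (f : C -> C) (c : nat -> C) :
  0 <= gamma < 1 -> has_expansion gamma k f c ->
  forall w : C, Cmod w < 1 ->
  @is_series C_AbsRing C_NormedModule
    (fun m => disk_coeff gamma k c m * w ^ (k + m))%C
    (f (RtoC (center gamma) + w / RtoC (1 - gamma))%C).
Proof.
  intros Hg Hf w Hw.
  assert (Hnz : RtoC (1 - gamma) <> 0) by (intros Z; apply RtoC_inj in Z; lra).
  set (z := (RtoC (center gamma) + w / RtoC (1 - gamma))%C).
  assert (Ez : (z - RtoC (center gamma) = w / RtoC (1 - gamma))%C)
    by (unfold z; ring).
  assert (Hz : Omega gamma z) by exact (Omega_of_disk gamma w Hg Hw).
  apply (is_series_ext (V := C_NormedModule)) with (2 := Hf z Hz).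
  intros m; rewrite Ez; unfold disk_coeff, Cdiv.
  rewrite Cpow_mult_l, Cpow_inv, RtoC_pow by exact Hnz.
  eq_in C; ring.
Qed.

Theorem bohr_lhs_le_majorant (gamma : R) (k : nat) (f : C -> C) (c : nat -> C) :
  0 <= gamma < 1 ->
  (forall z, Omega gamma z -> Cmod (f z) <= 1) -> has_expansion gamma k f c ->
  forall rho : R, 0 < rho < 1 ->
  bohr_summable gamma k c rho /\
  bohr_lhs gamma k c rho <= bohr_majorant k (lead gamma k c) rho.
Proof.
  intros Hg Hf Hc rho Hrho.
  assert (HT := toeplitz_form_bound (disk_coeff gamma k c) k _
    (has_expansion_disk gamma k f c Hg Hc)
    (fun w Hw => Hf _ (Omega_of_disk gamma w Hg Hw))).
  destruct (refined_bohr_inequality _ rho (carlson_inequality _ HT) Hrho)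
    as (H1 & H2 & H3).
  split; [apply bohr_summable_intro; [lra|assumption|assumption]|].
  rewrite bohr_lhs_eq by lra; rewrite <- lead_eq in H3 by lra.
  unfold bohr_majorant in *; apply Rmult_le_compat_l; [apply pow_le; lra|].
  rewrite pow_O, Rmult_1_l in H3; exact H3.
Qed.

(** * The extremal functions *)

(** The product and chain rules are stated for functions whose target is the
    field as a module over itself, hence this choice of the target. *)
Definition is_Cderive (f : C -> C) (z l : C) : Prop :=
  @is_derive C_AbsRing (AbsRing_NormedModule C_AbsRing) f z l.

(** The two normed-module structures on the target have the same operations and
    the same norm, but different balls.  The definition of the derivative uses
    only norms in the target, so it does not see the difference. *)
Lemma ex_derive_of_is_Cderive (f : C -> C) (z l : C) :
  is_Cderive f z l -> @ex_derive C_AbsRing C_NormedModule f z.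
Proof.
  intros [[Hplus Hscal Hnorm] Hdom]; exists l; split; [|exact Hdom].
  split; [exact Hplus|exact Hscal|exact Hnorm].
Qed.

Lemma is_Cderive_ext (f g : C -> C) (z l : C) :
  (forall u, f u = g u) -> is_Cderive f z l -> is_Cderive g z l.
Proof.
  exact (is_derive_ext (K := C_AbsRing) (V := AbsRing_NormedModule C_AbsRing)
           f g z l).
Qed.

Lemma is_Cderive_comp (f g : C -> C) (z df dg : C) :
  is_Cderive f (g z) df -> is_Cderive g z dg ->
  is_Cderive (fun u => f (g u)) z (dg * df)%C.
Proof.
  exact (is_derive_comp (K := C_AbsRing) (V := AbsRing_NormedModule C_AbsRing)
           f g z df dg).
Qed.

Lemma is_Cderive_mult (f g : C -> C) (z df dg : C) :
  is_Cderive f z df -> is_Cderive g z dg ->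
  is_Cderive (fun u => f u * g u)%C z (df * g z + f z * dg)%C.
Proof.
  intros Hf Hg.
  exact (is_derive_mult (K := C_AbsRing) f g z df dg Hf Hg Cmult_comm).
Qed.

Lemma is_Cderive_affine (p q z : C) : is_Cderive (fun u => p * u + q)%C z p.
Proof.
  assert (Hlin : is_Cderive (fun u => p * u)%C z (0 * z + p * 1)%C).
  { apply is_Cderive_mult; [exact (is_derive_const _ _)|exact (is_derive_id _)]. }
  assert (H := is_derive_plus (K := C_AbsRing) _ _ z _ _ Hlin
                 (is_derive_const (K := C_AbsRing)
                    (V := AbsRing_NormedModule C_AbsRing) q z)).
  change (is_Cderive (fun u => p * u + q)%C z (0 * z + p * 1 + 0)%C) in H.
  replace (0 * z + p * 1 + 0)%C with p in H by ring.
  exact H.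
Qed.

Lemma is_Cderive_pow (f : C -> C) (z df : C) (n : nat) :
  is_Cderive f z df -> exists l : C, is_Cderive (fun u => f u ^ n)%C z l.
Proof.
  intros Hf; induction n as [|n [l Hl]].
  - exists 0; exact (is_derive_const (K := C_AbsRing)
      (V := AbsRing_NormedModule C_AbsRing) (RtoC 1) z).
  - eexists; exact (is_Cderive_mult _ _ _ _ _ Hf Hl).
Qed.

(** The remainder of the difference quotient is [(u - z) ^ 2 / (u z ^ 2)], and
    [|u| >= |z| / 2] close to [z]. *)
Lemma is_Cderive_inv (z : C) : z <> 0 -> is_Cderive Cinv z (- / (z * z))%C.
Proof.
  intros Hz; assert (Hm := proj1 (Cmod_gt_0 z) Hz).
  split; [apply is_linear_scal_l|].
  intros x Hx.
  assert (E : z = x) by exact (is_filter_lim_locally_unique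
    (V := AbsRing_NormedModule C_AbsRing) z x Hx).
  subst x.
  intros eps; assert (Heps := cond_pos eps).
  assert (Hm3 : 0 < Cmod z ^ 3) by (apply pow_lt; exact Hm).
  set (delta := Rmin (Cmod z / 2) (eps * (Cmod z ^ 3 / 2))).
  assert (Hdelta : 0 < delta) by (apply Rmin_pos; nra).
  exists (mkposreal delta Hdelta); intros u Hu.
  change (Cmod (u - z)%C < delta) in Hu.
  change (Cmod ((/ u - / z) - (u - z) * - / (z * z))%C <= eps * Cmod (u - z)%C).
  assert (Hd1 : delta <= Cmod z / 2) by apply Rmin_l.
  assert (Hd2 : delta <= eps * (Cmod z ^ 3 / 2)) by apply Rmin_r.
  assert (Hu2 : Cmod z / 2 <= Cmod u).
  { assert (H := Cmod_triangle u (- (u - z))%C); rewrite Cmod_opp in H.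
    replace (u + - (u - z))%C with z in H by ring; lra. }
  assert (Hunz : u <> RtoC 0 :> C) by (apply Cmod_gt_0; lra).
  replace ((/ u - / z) - (u - z) * - / (z * z))%C
    with ((u - z) * ((u - z) / (u * (z * z))))%C by (field; auto).
  rewrite Cmod_mult, (Rmult_comm eps).
  apply Rmult_le_compat_l; [apply Cmod_ge_0|].
  assert (Hnz : (u * (z * z))%C <> 0)
    by (repeat apply Cmult_neq_0; assumption).
  rewrite Cmod_div, !Cmod_mult by exact Hnz.
  apply Rle_div_l; [nra|].
  apply Rle_trans with (eps * (Cmod z ^ 3 / 2)); [lra|].
  apply Rmult_le_compat_l; [lra|simpl; nra].
Qed.

Definition moebius (a : R) (w : C) : C := ((a - w) / (1 - a * w))%C.

(** The Taylor coefficients of [moebius a] at the origin. *)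
Definition moebius_coeff (a : R) (m : nat) : R :=
  match m with O => a | S n => - (1 - a ^ 2) * a ^ n end.

Definition disk_coordinate (gamma : R) (z : C) : C :=
  (RtoC (1 - gamma) * (z - RtoC (center gamma)))%C.

Definition extremal (gamma : R) (k : nat) (a : R) (z : C) : C :=
  let w := disk_coordinate gamma z in (w ^ k * moebius a w)%C.

Definition extremal_coeff (gamma : R) (k : nat) (a : R) (n : nat) : C :=
  RtoC (moebius_coeff a (n - k) * (1 - gamma) ^ n).

Lemma moebius_denominator (a : R) (w : C) :
  0 < a < 1 -> Cmod w < 1 -> 1 - a <= Cmod (1 - a * w)%C.
Proof.
  intros Ha Hw.
  assert (H := Cmod_triangle (1 - a * w) (a * w)).
  replace (1 - a * w + a * w)%C with (RtoC 1) in H by ring.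
  rewrite Cmod_1, Cmod_mult, Cmod_R, Rabs_pos_eq in H by lra.
  nra.
Qed.

Lemma moebius_denominator_neq_0 (a : R) (w : C) :
  0 < a < 1 -> Cmod w < 1 -> (1 - a * w)%C <> 0.
Proof.
  intros Ha Hw; apply Cmod_gt_0.
  assert (H := moebius_denominator a w Ha Hw); lra.
Qed.

(** [|1 - a w| ^ 2 - |a - w| ^ 2 = (1 - a ^ 2) (1 - |w| ^ 2)]. *)
Lemma Cmod_moebius_le (a : R) (w : C) :
  0 < a < 1 -> Cmod w < 1 -> Cmod (moebius a w) <= 1.
Proof.
  intros Ha Hw; assert (Hd := moebius_denominator a w Ha Hw).
  unfold moebius; rewrite Cmod_div by now apply moebius_denominator_neq_0.
  apply Rle_div_l; [lra|]; rewrite Rmult_1_l.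
  apply Rsqr_incr_0; [|apply Cmod_ge_0|lra].
  assert (E : forall v, Rsqr (Cmod v) = fst v ^ 2 + snd v ^ 2).
  { intros v; rewrite Rsqr_pow2; exact (Cmod2_alt v). }
  assert (Hw2 : Rsqr (Cmod w) < Rsqr 1).
  { apply Rsqr_incrst_1; [exact Hw|apply Cmod_ge_0|lra]. }
  rewrite !E; rewrite E in Hw2; destruct w as [x y];
  unfold Rsqr in Hw2; cbn [fst snd] in Hw2.
  apply Rminus_le_0.
  match goal with |- 0 <= ?t =>
    replace t with ((1 - a ^ 2) * (1 * 1 - (x ^ 2 + y ^ 2)))
      by (simpl; ring) end.
  apply Rmult_le_pos; nra.
Qed.

Lemma disk_coordinate_lt (gamma : R) (z : C) :
  0 <= gamma < 1 -> Omega gamma z -> Cmod (disk_coordinate gamma z) < 1.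
Proof.
  unfold Omega, disk_coordinate; intros Hg Hz.
  rewrite Cmod_mult, Cmod_R, Rabs_pos_eq by lra.
  apply (Rmult_lt_compat_l (1 - gamma)) in Hz; [|lra].
  replace ((1 - gamma) * (1 / (1 - gamma))) with 1 in Hz by (field; lra).
  exact Hz.
Qed.

Lemma extremal_classB (gamma : R) (k : nat) (a : R) :
  0 <= gamma < 1 -> 0 < a < 1 -> classB (Omega gamma) (extremal gamma k a).
Proof.
  intros Hg Ha; split; intros z Hz;
    assert (Hw := disk_coordinate_lt gamma z Hg Hz).
  - assert (Hnz := moebius_denominator_neq_0 a _ Ha Hw).
    set (g := RtoC (1 - gamma)); set (c := RtoC (center gamma)).
    assert (Hwd : is_Cderive (disk_coordinate gamma) z g).
    { apply (is_Cderive_ext (fun u => g * u + - (g * c))%C);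
        [|apply is_Cderive_affine].
      intros u; unfold disk_coordinate; fold g c; ring. }
    destruct (is_Cderive_pow _ z _ k Hwd) as [l Hl].
    assert (Hn := is_Cderive_comp (fun w => - (1) * w + a)%C _ z _ _
                    (is_Cderive_affine (- (1))%C a _) Hwd).
    assert (Hd := is_Cderive_comp (fun w => - a * w + 1)%C _ z _ _
                    (is_Cderive_affine (- a)%C 1 _) Hwd).
    replace (1 - a * disk_coordinate gamma z)%C
      with (- a * disk_coordinate gamma z + 1)%C in Hnz by ring.
    assert (Hi := is_Cderive_comp Cinv _ z _ _ (is_Cderive_inv _ Hnz) Hd).
    refine (ex_derive_of_is_Cderive _ z _ _).
    apply (is_Cderive_ext (fun u => disk_coordinate gamma u ^ k
      * ((- (1) * disk_coordinate gamma u + a)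
         * / (- a * disk_coordinate gamma u + 1)))%C).
    + intros u; unfold extremal, moebius, Cdiv.
      f_equal; f_equal; [ring|f_equal; ring].
    + exact (is_Cderive_mult _ _ z _ _ Hl (is_Cderive_mult _ _ z _ _ Hn Hi)).
  - unfold extremal; rewrite Cmod_mult, Cmod_pow.
    assert (H1 := Cmod_moebius_le a _ Ha Hw).
    assert (H0 := Cmod_ge_0 (moebius a (disk_coordinate gamma z))).
    assert (Hp : 0 <= Cmod (disk_coordinate gamma z) ^ k)
      by (apply pow_le, Cmod_ge_0).
    assert (Hp1 : Cmod (disk_coordinate gamma z) ^ k <= 1).
    { rewrite <- (pow1 k); apply pow_incr; split; [apply Cmod_ge_0|lra]. }
    nra.
Qed.

Lemma moebius_partial_sum (a : R) (w : C) (n : nat) :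
  ((1 - a * w) * Csum (fun m => RtoC (moebius_coeff a m) * w ^ m) n
   = (a - w) + RtoC ((1 - a ^ 2) * a ^ n) * w ^ S n)%C.
Proof.
  induction n as [|n IH].
  - rewrite Csum_O, Cpow_1_r.
    replace ((1 - a ^ 2) * a ^ 0) with (1 - a * a) by ring.
    rewrite RtoC_minus, RtoC_mult.
    change (moebius_coeff a 0) with a; change (w ^ 0)%C with (RtoC 1); ring.
  - rewrite Csum_S, Cmult_plus_distr_l, IH; unfold moebius_coeff.
    rewrite <- (tech_pow_Rmult a n), !Cpow_S, !RtoC_mult, RtoC_opp; ring.
Qed.

Lemma moebius_expansion (a : R) (k : nat) (w : C) :
  0 < a < 1 -> Cmod w < 1 ->
  @is_series C_AbsRing C_NormedModule
    (fun m => RtoC (moebius_coeff a m) * w ^ (k + m))%C (w ^ k * moebius a w)%C.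
Proof.
  intros Ha Hw; apply is_series_C_intro; intros eps.
  assert (Hnz := moebius_denominator_neq_0 a w Ha Hw).
  assert (Hd := moebius_denominator a w Ha Hw).
  destruct (pow_lt_1_zero a ltac:(rewrite Rabs_pos_eq; lra) (eps / 2)
    ltac:(assert (H := cond_pos eps); lra)) as [n0 Hn0].
  exists n0; intros n Hn.
  assert (Han := Hn0 n Hn).
  assert (Hapos : 0 < a ^ n) by (apply pow_lt; lra).
  rewrite Rabs_pos_eq in Han by lra.
  rewrite (Csum_ext _ (fun m => w ^ k * (RtoC (moebius_coeff a m) * w ^ m))%C).
  2:{ intros m _; rewrite Cpow_add_r; ring. }
  rewrite Csum_mult_l.
  replace (Csum (fun m => RtoC (moebius_coeff a m) * w ^ m) n)%C
    with (((a - w) + RtoC ((1 - a ^ 2) * a ^ n) * w ^ S n) / (1 - a * w))%C.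
  2:{ rewrite <- moebius_partial_sum; field; exact Hnz. }
  replace (w ^ k * ((a - w + RtoC ((1 - a ^ 2) * a ^ n) * w ^ S n)
             / (1 - a * w)) - w ^ k * moebius a w)%C
    with (w ^ (k + S n) * RtoC ((1 - a ^ 2) * a ^ n) / (1 - a * w))%C.
  2:{ unfold moebius; rewrite Cpow_add_r; field; exact Hnz. }
  rewrite Cmod_div, Cmod_mult, Cmod_pow, Cmod_R by exact Hnz.
  assert (Hp : 0 < (1 - a ^ 2) * a ^ n) by (apply Rmult_lt_0_compat; nra).
  rewrite Rabs_pos_eq by lra.
  apply Rlt_div_l; [lra|].
  assert (Hpow0 : 0 <= Cmod w ^ (k + S n)) by (apply pow_le, Cmod_ge_0).
  assert (Hpow1 : Cmod w ^ (k + S n) <= 1).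
  { rewrite <- (pow1 (k + S n)); apply pow_incr; split; [apply Cmod_ge_0|lra]. }
  apply Rle_lt_trans with ((1 - a ^ 2) * a ^ n); [nra|].
  apply Rlt_le_trans with (eps * (1 - a)).
  - replace ((1 - a ^ 2) * a ^ n) with ((1 - a) * ((1 + a) * a ^ n)) by ring.
    rewrite (Rmult_comm eps); apply Rmult_lt_compat_l; nra.
  - apply Rmult_le_compat_l; [apply Rlt_le, cond_pos|exact Hd].
Qed.

Lemma extremal_expansion (gamma : R) (k : nat) (a : R) :
  0 <= gamma < 1 -> 0 < a < 1 ->
  has_expansion gamma k (extremal gamma k a) (extremal_coeff gamma k a).
Proof.
  intros Hg Ha z Hz.
  apply (is_series_ext (V := C_NormedModule)) with
    (2 := moebius_expansion a k _ Ha (disk_coordinate_lt gamma z Hg Hz)).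
  intros m; unfold extremal_coeff, disk_coordinate.
  replace (k + m - k)%nat with m by lia.
  rewrite Cpow_mult_l, RtoC_mult, RtoC_pow.
  eq_in C; ring.
Qed.

Lemma extremal_disk_coeff (gamma : R) (k : nat) (a : R) (m : nat) :
  gamma < 1 ->
  disk_coeff gamma k (extremal_coeff gamma k a) m = RtoC (moebius_coeff a m).
Proof.
  intros Hg; unfold disk_coeff, extremal_coeff.
  assert (Hp : 0 < (1 - gamma) ^ (k + m)) by (apply pow_lt; lra).
  replace (k + m - k)%nat with m by lia.
  rewrite RtoC_mult; field; intros Z; apply RtoC_inj in Z; lra.
Qed.

Lemma is_series_geom_from_1 (u0 s q : R) :
  0 <= q < 1 ->
  is_series (fun m => match m with O => u0 | S n => s * q ^ n end)
            (u0 + s / (1 - q)).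
Proof.
  intros Hq; apply (is_series_decr_1 (V := R_NormedModule)).
  replace (plus _ _) with (s * / (1 - q)).
  - apply (is_series_scal_l (V := R_NormedModule) s), is_series_geom.
    rewrite Rabs_pos_eq; lra.
  - change (s * / (1 - q) = u0 + s / (1 - q) - u0); field; lra.
Qed.

(** The coefficients after the first form a geometric progression, so both
    series have closed forms, and their weighted sum simplifies to the
    majorant because [1 / (1 + a) + rho / (1 - rho)] has numerator
    [1 + a rho], a factor of [1 - (a rho) ^ 2]. *)
Lemma extremal_bohr_lhs (gamma : R) (k : nat) (a rho : R) :
  gamma < 1 -> 0 < a < 1 -> 0 < rho < 1 ->
  bohr_summable gamma k (extremal_coeff gamma k a) rho /\
  bohr_lhs gamma k (extremal_coeff gamma k a) rho = bohr_majorant k a rho.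
Proof.
  intros Hg Ha Hrho; set (c := extremal_coeff gamma k a).
  assert (Hmod : forall m, Cmod (disk_coeff gamma k c m)
     = match m with O => a | S n => (1 - a ^ 2) * a ^ n end).
  { intros m; unfold c; rewrite extremal_disk_coeff, Cmod_R by exact Hg.
    destruct m as [|n]; simpl moebius_coeff; [apply Rabs_pos_eq; lra|].
    assert (0 < a ^ n) by (apply pow_lt; lra).
    rewrite <- Ropp_mult_distr_l, Rabs_Ropp; apply Rabs_pos_eq.
    apply Rmult_le_pos; nra. }
  assert (Hq1 : 0 <= a * rho < 1) by nra.
  assert (Hq2 : 0 <= (a * rho) ^ 2 < 1) by nra.
  assert (H1 : is_series (fun m => Cmod (disk_coeff gamma k c m) * rho ^ m)
                 (a + (1 - a ^ 2) * rho / (1 - a * rho))).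
  { apply (is_series_ext (V := R_NormedModule)) with
      (2 := is_series_geom_from_1 a ((1 - a ^ 2) * rho) _ Hq1).
    intros [|n]; rewrite Hmod.
    - eq_in R; ring.
    - rewrite Rpow_mult_distr, <- (tech_pow_Rmult rho); eq_in R; ring. }
  assert (H2 : is_series
                 (fun m => Cmod (disk_coeff gamma k c m) ^ 2 * (rho ^ 2) ^ m)
                 (a ^ 2 + (1 - a ^ 2) ^ 2 * rho ^ 2 / (1 - (a * rho) ^ 2))).
  { apply (is_series_ext (V := R_NormedModule)) with
      (2 := is_series_geom_from_1 (a ^ 2) ((1 - a ^ 2) ^ 2 * rho ^ 2) _ Hq2).
    intros [|n]; rewrite Hmod.
    - eq_in R; ring.
    - rewrite <- (tech_pow_Rmult (rho ^ 2)), Rpow_mult_distr, Rpow_mult_distr.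
      rewrite (Rpow_mult_distr (1 - a ^ 2)), <- !pow_mult, (Nat.mul_comm n 2).
      eq_in R; ring. }
  split.
  - apply bohr_summable_intro; [exact Hg|eexists; exact H1|eexists; exact H2].
  - rewrite bohr_lhs_eq by lra.
    rewrite lead_eq, (Hmod O) by exact Hg.
    rewrite (is_series_unique _ _ H1), (is_series_unique _ _ H2).
    unfold bohr_majorant, bohr_weight; f_equal; field; nra.
Qed.

Theorem theorem3p5 :
  forall (gamma : R) (k : nat), 0 <= gamma < 1 ->
    (* the root exists and is unique; for k = 0 and 2 a^2 >= 1 there is none *)
    (forall a : R, 0 <= a <= 1 -> ((1 <= k)%nat \/ 2 * a ^ 2 < 1) ->
       exists! r : R, is_rho k a r)
    /\
    (forall (f : C -> C) (c : nat -> C),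
       classB (Omega gamma) f -> has_expansion gamma k f c ->
       forall r : R, is_rho k (lead gamma k c) r ->
       forall rho : R, 0 < rho <= r ->
         bohr_summable gamma k c rho /\ bohr_lhs gamma k c rho <= 1)
    /\
    (forall a : R, 0 < a < 1 ->
       forall r : R, is_rho k a r ->
       forall rho : R, r < rho < 1 ->
         exists (f : C -> C) (c : nat -> C),
           classB (Omega gamma) f /\ has_expansion gamma k f c /\
           lead gamma k c = a /\
           bohr_summable gamma k c rho /\ 1 < bohr_lhs gamma k c rho).
Proof.
  intros gamma k Hg; split; [|split].
  - intros a Ha Hk; apply is_rho_exists_unique; [lra|exact Hk].
  - intros f c [_ Hf] Hc r Hr rho Hrho.
    assert (Hl : 0 <= lead gamma k c).
    { rewrite lead_eq by lra; apply Cmod_ge_0. }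
    apply is_rho_iff in Hr; [|exact Hl].
    destruct (bohr_lhs_le_majorant gamma k f c Hg Hf Hc rho ltac:(lra))
      as [Hsum Hle].
    split; [exact Hsum|].
    apply Rle_trans with (1 := Hle).
    destruct (Req_dec rho r) as [->|Hne]; [lra|].
    assert (H := bohr_majorant_increasing k (lead gamma k c) rho r Hl
                   ltac:(lra) ltac:(lra)); lra.
  - intros a Ha r Hr rho Hrho; apply is_rho_iff in Hr; [|lra].
    destruct (extremal_bohr_lhs gamma k a rho ltac:(lra) Ha ltac:(lra))
      as [Hsum Heq].
    exists (extremal gamma k a), (extremal_coeff gamma k a).
    split; [now apply extremal_classB|].
    split; [now apply extremal_expansion|].
    split; [|split; [exact Hsum|]].
    + rewrite lead_eq, extremal_disk_coeff, Cmod_R by lra.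
      apply Rabs_pos_eq; simpl; lra.
    + rewrite Heq.
      assert (H := bohr_majorant_increasing k a r rho ltac:(lra) ltac:(lra)
                     ltac:(lra)); lra.
Qed.
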